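(* Let $T$ be a complete NIP $L$-theory, $M \models T$, $T' := \mathrm{Th}_{L'}(M^{\mathrm{Sh}})$ and $\widetilde{M}'$ a monster model of $T'$ with $L$-reduct $M'$. Then the map $\bar{\mu}' \in \mathfrak{M}_x^{L'}(M') \mapsto \bar{\mu} := \bar{\mu}'\restriction_{L} \in \mathfrak{M}_x^{L}(M')$ defines a bijection between global generically stable measures in $T'$ and global generically stable measures in $T$. Moreover, $\bar{\mu}'$ is the unique measure in $\mathfrak{M}_x^{L'}(M')$ extending $\bar{\mu}$; and for any small set $A \subset M'$: (1) if $\bar{\mu}'$ is fam over $A$ in $T'$, then $\bar{\mu}$ is fam over $A$ in $T$; (2) if $\bar{\mu}$ is generically stable over $A$ in $T$, then $\bar{\mu}'$ is generically stable over $A$ in $T'$.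
   Context: Shelah expansion. Fix an $|M|^+$-saturated $N \succeq M$. $M^{\mathrm{Sh}}$ is the expansion of $M$ in the language $L'$ with a relation symbol $R_{\varphi(x,d)}$, interpreted as $\varphi(M,d)=\{a\in M^n:N\models\varphi(a,d)\}$, for every $\varphi(x,y)\in L$ and $d$ in $N$ (for $\varphi(x) \in L$ one identifies $R_{\varphi(x)}$ with $\varphi$). Let $(N',M')\succ(N,M)$ be a sufficiently (at least $|N|^+$-) saturated elementary extension of the pair in the language $L\cup\{P\}$, $P$ naming $M$; $\widetilde{M}'$ is the $L'$-structure on $M'$ with $R_{\varphi(x,d)}$ interpreted as $\varphi(M',d)$ (computed in $N'$). It is a monster model of $T'$, and its $L$-reduct $M'$ is a monster model of $T$. Measures. $\mathfrak{M}^{L}_x(M')$ (resp. $\mathfrak{M}^{L'}_x(M')$) is the set of Keisler measures in variable $x$ over $M'$, i.e. finitely additive probability measures on $L(M')$- (resp. $L'(M')$-) definable subsets of $(M')^x$; $\restriction_L$ denotes restriction to $L(M')$-definable sets. In an NIP theory with monster model $\mathbb{M}$, $\mu\in\mathfrak{M}_x(\mathbb{M})$ is generically stable if for some small model $M_1\prec\mathbb{M}$ it is both definable over $M_1$ ($M_1$-invariant, with $\mathrm{tp}(b/M_1)\mapsto\mu(\varphi(x,b))$ continuous on $S_y(M_1)$ for every $\varphi(x,y)$) and finitely satisfiable in $M_1$ (every $\varphi(x)$ of positive measure is realized in $M_1$). $\mu$ is generically stable over a small set $A$ if it is generically stable and $A$-invariant. $\mu$ is fam over $A$ if for every $\varphi(x,y)$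 over $\emptyset$ and $\varepsilon>0$ there are $n$ and $a_1,\dots,a_n\in A^x$ with $\left|\tfrac1n|\{i:\models\varphi(a_i,b)\}|-\mu(\varphi(x,b))\right|\le\varepsilon$ for every $b\in\mathbb{M}^y$. *)

(* Defs.v *)
From HB Require Import structures.
From mathcomp Require Import all_boot all_order all_algebra.
From mathcomp Require Import all_classical all_reals all_analysis.

Set Implicit Arguments.
Unset Strict Implicit.
Unset Printing Implicit Defensive.

Import Order.TTheory GRing.Theory Num.Theory.
Import numFieldNormedType.Exports.

Local Open Scope classical_set_scope.
Local Open Scope ring_scope.

Record language : Type := Language {
  fsym : Type;
  farity : fsym -> nat;
  rsym : Type;
  rarity : rsym -> nat }.

Record structure (L : language) : Type := Structure {
  carrier :> Type;
  carrier_inhabited : inhabited carrier;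
  finterp : forall f : fsym L, ('I_(farity f) -> carrier) -> carrier;
  rinterp : forall r : rsym L, set ('I_(rarity r) -> carrier) }.

Arguments finterp {L X} f _ : rename.
Arguments rinterp {L X} r _ : rename.

Inductive term (L : language) (n : nat) : Type :=
| Var of 'I_n
| App (f : fsym L) of ('I_(farity f) -> term L n).

(* [formula L n]: formulas with free variables among the [i : 'I_n]. In
   [All phi] the bound variable is number 0 of [phi]. *)
Inductive formula (L : language) (n : nat) : Type :=
| Equal of term L n & term L n
| Rel (r : rsym L) of ('I_(rarity r) -> term L n)
| Bot
| Imp of formula L n & formula L n
| All of formula L n.+1.

Arguments Var {L n} _.
Arguments App {L n} f _.
Arguments Equal {L n} _ _.
Arguments Rel {L n} r _.
Arguments Bot {L n}.
Arguments Imp {L n} _ _.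
Arguments All {L n} _.

Definition Neg (L : language) (n : nat) (phi : formula L n) : formula L n :=
  Imp phi Bot.

Definition tcons (X : Type) (n : nat) (a : X) (v : 'I_n -> X) : 'I_n.+1 -> X :=
  fun i => if unlift ord0 i is Some j then v j else a.

Definition tcat (X : Type) (n m : nat) (a : 'I_n -> X) (b : 'I_m -> X) :
    'I_(n + m) -> X :=
  fun i => match fintype.split i with inl j => a j | inr k => b k end.

Fixpoint teval (L : language) (X : structure L) (n : nat) (t : term L n)
    (v : 'I_n -> X) : X :=
  match t with
  | Var i => v i
  | App f ts => finterp f (fun i => teval (ts i) v)
  end.

Fixpoint holds (L : language) (X : structure L) (n : nat) (phi : formula L n) :
    ('I_n -> X) -> Prop :=
  match phi with
  | Equal s t => fun v => teval s v = teval t v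
  | Rel r ts => fun v => rinterp r (fun i => teval (ts i) v)
  | Bot => fun=> False
  | Imp p q => fun v => holds p v -> holds q v
  | All p => fun v => forall a : X, holds p (tcons a v)
  end.

Definition theory (L : language) : Type := set (formula L 0).

Definition satisfies (L : language) (X : structure L) (s : formula L 0) : Prop :=
  forall v : 'I_0 -> X, holds s v.

Definition models (L : language) (X : structure L) (T : theory L) : Prop :=
  forall s, T s -> satisfies X s.

Definition Th (L : language) (X : structure L) : theory L :=
  [set s | satisfies X s].

Definition entails (L : language) (T : theory L) (s : formula L 0) : Prop :=
  forall X : structure L, models X T -> satisfies X s.

Definition complete_theory (L : language) (T : theory L) : Prop :=
  (exists X : structure L, models X T) /\
  forall s, entails T s \/ entails T (Neg s).

(* phi(x,y) is NIP in T: its Vapnik-Chervonenkis dimension is finite, i.e. for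
   some k no model of T has a shattered family of k tuples. *)
Definition NIP_formula (L : language) (T : theory L) (n m : nat)
    (phi : formula L (n + m)) : Prop :=
  exists k : nat, forall X : structure L, models X T ->
    ~ exists a : 'I_k -> 'I_n -> X,
        forall s : {set 'I_k}, exists b : 'I_m -> X,
        forall i, holds phi (tcat (a i) b) <-> i \in s.

Definition NIP (L : language) (T : theory L) : Prop :=
  forall n m (phi : formula L (n + m)), NIP_formula T phi.

Definition embedding (L : language) (X Y : structure L) (f : X -> Y) : Prop :=
  [/\ injective f,
      forall (s : fsym L) (v : 'I_(farity s) -> X),
        f (finterp s v) = finterp s (f \o v) &
      forall (r : rsym L) (v : 'I_(rarity r) -> X),
        rinterp r v <-> rinterp r (f \o v)].

Definition elementary_embedding (L : language) (X Y : structure L)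
    (f : X -> Y) : Prop :=
  forall n (phi : formula L n) (v : 'I_n -> X), holds phi v <-> holds phi (f \o v).

Definition elementary_substructure (L : language) (X : structure L)
    (A : set X) : Prop :=
  exists (S : structure L) (g : S -> X), elementary_embedding g /\ range g = A.

(* L(C)-formulas phi(x,c) in n free variables x, with c a tuple from C. *)
Record pformula (L : language) (C : Type) (n : nat) : Type := PFormula {
  pf_arity : nat;
  pf_formula : formula L (n + pf_arity);
  pf_param : 'I_pf_arity -> C }.

Arguments pf_param {L C n} p _ : rename.

Definition pholds (L : language) (X : structure L) (C : Type) (iota : C -> X)
    (n : nat) (psi : pformula L C n) (a : 'I_n -> X) : Prop :=
  holds (pf_formula psi) (tcat a (iota \o pf_param psi)).

Definition pneg (L : language) (C : Type) (n : nat) (psi : pformula L C n) :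
    pformula L C n :=
  PFormula (Neg (pf_formula psi)) (pf_param psi).

(* [pformula L A n], with [A : set X] coerced to a type, is the type of
   L(A)-formulas. *)
Definition finitely_satisfiable (L : language) (X : structure L) (A : set X)
    (n : nat) (p : set (pformula L A n)) : Prop :=
  forall q : set (pformula L A n), finite_set q -> q `<=` p ->
    exists a : 'I_n -> X, forall psi, q psi -> pholds set_val psi a.

Definition realizes_types_over (L : language) (X : structure L) (A : set X) : Prop :=
  forall n (p : set (pformula L A n)), finitely_satisfiable p ->
    exists a : 'I_n -> X, forall psi, p psi -> pholds set_val psi a.

(* |A| < |K|; the type K stands for the cardinal kappa = |K|. *)
Definition small (K : Type) (T : Type) (A : set T) : Prop :=
  (A #<= [set: K])%card /\ ~ ([set: K] #<= A)%card.

Definition saturated (K : Type) (L : language) (X : structure L) : Prop :=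
  forall A : set X, small K A -> realizes_types_over A.

(* |K|^+-saturation: |A| < |K|^+ means |A| <= |K|. *)
Definition succ_saturated (K : Type) (L : language) (X : structure L) : Prop :=
  forall A : set X, (A #<= [set: K])%card -> realizes_types_over A.

(* The cardinal |K| exceeds the number of L-formulas, so that small elementary
   substructures exist around every small set. *)
Definition monster (K : Type) (L : language) (T : theory L) (X : structure L) : Prop :=
  [/\ models X T, saturated K X & small K [set: {n : nat & formula L n}]].

(* S_y(A), with m = |y|: complete types over A, consistent with X. *)
Record type_space (L : language) (X : structure L) (A : set X) (m : nat) : Type :=
  CompleteType {
    type_mem :> set (pformula L A m);
    type_finsat : finitely_satisfiable type_mem;
    type_complete : forall psi, type_mem psi \/ type_mem (pneg psi) }.

Section TypeSpaceTopology.
Context (L : language) (X : structure L) (A : set X) (m : nat).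

HB.instance Definition _ := gen_eqMixin (type_space A m).
HB.instance Definition _ := gen_choiceMixin (type_space A m).

(* The logic topology, generated by the sets [psi] = {p | psi \in p}. *)
HB.instance Definition _ := @isSubBaseTopological.Build (type_space A m)
  (set (type_space A m))
  [set U | exists psi : pformula L A m, U = [set p : type_space A m | type_mem p psi]] id.

End TypeSpaceTopology.

Definition tp_mem (L : language) (X : structure L) (A : set X) (m : nat)
    (b : 'I_m -> X) : set (pformula L A m) :=
  [set psi | pholds set_val psi b].

Arguments tp_mem {L X} A {m} b _.

Lemma tp_finsat (L : language) (X : structure L) (A : set X) (m : nat)
  (b : 'I_m -> X) : finitely_satisfiable (tp_mem A b).
Proof. by move=> q _ qb; exists b => psi /qb. Qed.

Lemma tp_complete (L : language) (X : structure L) (A : set X) (m : nat)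
  (b : 'I_m -> X) (psi : pformula L A m) :
  tp_mem A b psi \/ tp_mem A b (pneg psi).
Proof. exact: EM. Qed.

Definition tp (L : language) (X : structure L) (A : set X) (m : nat)
    (b : 'I_m -> X) : type_space A m :=
  CompleteType (@tp_finsat L X A m b) (@tp_complete L X A m b).

Definition definable (L : language) (X : structure L) (n : nat)
    (D : set ('I_n -> X)) : Prop :=
  exists psi : pformula L X n, D = [set a | pholds id psi a].

Record definable_set (L : language) (X : structure L) (n : nat) : Type :=
  DefinableSet {
    dset :> set ('I_n -> X);
    dset_definable : definable dset }.

Definition instance_set (L : language) (X : structure L) (n m : nat)
    (phi : formula L (n + m)) (b : 'I_m -> X) : definable_set X n :=
  DefinableSet (ex_intro _ (PFormula phi b) erefl).

Record keisler (R : realType) (L : language) (X : structure L) (n : nat) : Type :=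
  Keisler {
    keisler_fun :> definable_set X n -> R;
    keisler_ge0 : forall D, 0 <= keisler_fun D;
    keisler_setT : forall D, dset D = setT -> keisler_fun D = 1;
    keisler_setU : forall D1 D2 D : definable_set X n,
      dset D1 `&` dset D2 = set0 -> dset D = dset D1 `|` dset D2 ->
      keisler_fun D = keisler_fun D1 + keisler_fun D2 }.

Definition invariant_over (R : realType) (L : language) (X : structure L)
    (n : nat) (mu : keisler R X n) (A : set X) : Prop :=
  forall m (phi : formula L (n + m)) (b b' : 'I_m -> X),
    tp A b = tp A b' -> mu (instance_set phi b) = mu (instance_set phi b').

Definition definable_over (R : realType) (L : language) (X : structure L)
    (n : nat) (mu : keisler R X n) (A : set X) : Prop :=
  invariant_over mu A /\
  forall m (phi : formula L (n + m)),
    exists F : type_space A m -> R,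
      continuous F /\ forall b, F (tp A b) = mu (instance_set phi b).

Definition finitely_satisfiable_in (R : realType) (L : language)
    (X : structure L) (n : nat) (mu : keisler R X n) (A : set X) : Prop :=
  forall D : definable_set X n, 0 < mu D ->
    exists a : 'I_n -> X, (forall i, A (a i)) /\ dset D a.

Definition generically_stable (K : Type) (R : realType) (L : language)
    (X : structure L) (n : nat) (mu : keisler R X n) : Prop :=
  exists M1 : set X,
    [/\ small K M1, elementary_substructure M1,
        definable_over mu M1 & finitely_satisfiable_in mu M1].

Definition generically_stable_over (K : Type) (R : realType) (L : language)
    (X : structure L) (n : nat) (mu : keisler R X n) (A : set X) : Prop :=
  generically_stable K mu /\ invariant_over mu A.

Definition fam_over (R : realType) (L : language) (X : structure L) (n : nat)
    (mu : keisler R X n) (A : set X) : Prop :=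
  forall m (phi : formula L (n + m)) (e : R), 0 < e ->
    exists (k : nat) (a : 'I_k.+1 -> 'I_n -> X),
      (forall j i, A (a j i)) /\
      forall b : 'I_m -> X,
        `| #|[set j | `[< holds phi (tcat (a j) b) >]]%SET|%:R / k.+1%:R
           - mu (instance_set phi b) | <= e.

Definition add_rel (L : language) (S : Type) (ar : S -> nat) : language :=
  @Language (fsym L) (@farity L) (rsym L + S)
    (fun r => match r with inl r => rarity r | inr s => ar s end).

Definition expansion (L : language) (S : Type) (ar : S -> nat)
    (X : structure L) (I : forall s : S, set ('I_(ar s) -> X)) :
    structure (add_rel L ar) :=
  @Structure (add_rel L ar) X (carrier_inhabited X) (@finterp L X)
    (fun r => match r with inl r => @rinterp L X r | inr s => I s end).

Definition reduct (L : language) (S : Type) (ar : S -> nat)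
    (X : structure (add_rel L ar)) : structure L :=
  @Structure L X (carrier_inhabited X) (@finterp _ X)
    (fun r => @rinterp _ X (inl r)).

Section Restriction.
Context (L : language) (S : Type) (ar : S -> nat).
Let L' := add_rel L ar.

Fixpoint lift_term (n : nat) (t : term L n) : term L' n :=
  match t with
  | Var i => Var i
  | App f ts => @App L' n f (fun i => lift_term (ts i))
  end.

Fixpoint lift_formula (n : nat) (phi : formula L n) : formula L' n :=
  match phi with
  | Equal s t => Equal (lift_term s) (lift_term t)
  | Rel r ts => @Rel L' n (inl r) (fun i => lift_term (ts i))
  | Bot => Bot
  | Imp p q => Imp (lift_formula p) (lift_formula q)
  | All p => All (lift_formula p)
  end.

Context (X : structure L').

Lemma teval_lift (n : nat) (t : term L n) (v : 'I_n -> reduct X) :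
  @teval L' X n (lift_term t) v = @teval L (reduct X) n t v.
Proof.
elim: t => //= f ts IH.
by congr finterp; apply: funext => i; rewrite IH.
Qed.

Lemma holds_lift (n : nat) (phi : formula L n) (v : 'I_n -> reduct X) :
  @holds L' X n (lift_formula phi) v = @holds L (reduct X) n phi v.
Proof.
elim: phi v => /= {n} [n s t v|n r ts v|n v|n p IHp q IHq v|n p IHp v].
- by rewrite !teval_lift.
- by congr rinterp; apply: funext => i; rewrite teval_lift.
- by [].
- by rewrite IHp IHq.
- by apply: eq_forall => a; exact: IHp.
Qed.

Lemma definable_lift (n : nat) (D : definable_set (reduct X) n) :
  @definable L' X n (dset D).
Proof.
case: D => D [[k phi c] DE] /=; exists (PFormula (lift_formula phi) c).
by rewrite DE; apply: funext => a; rewrite /= /pholds /= holds_lift.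
Qed.

Definition lift_set (n : nat) (D : definable_set (reduct X) n) :
    definable_set X n :=
  DefinableSet (definable_lift D).

Context (R : realType) (n : nat) (mu : keisler R X n).

Definition restrict_fun (D : definable_set (reduct X) n) : R := mu (lift_set D).

Lemma restrict_ge0 D : 0 <= restrict_fun D.
Proof. exact: keisler_ge0. Qed.

Lemma restrict_setT D : dset D = setT -> restrict_fun D = 1.
Proof. by move=> DT; apply: keisler_setT. Qed.

Lemma restrict_setU (D1 D2 D : definable_set (reduct X) n) :
  dset D1 `&` dset D2 = set0 -> dset D = dset D1 `|` dset D2 ->
  restrict_fun D = restrict_fun D1 + restrict_fun D2.
Proof. by move=> D0 DU; apply: keisler_setU. Qed.

Definition restrict_keisler : keisler R (reduct X) n :=
  Keisler restrict_ge0 restrict_setT restrict_setU.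

End Restriction.

Arguments restrict_keisler {L S ar X R n} mu.

(* (N, M) as a structure in the language L + {P}, with M seen in N through
   [i] and P naming its image. *)
Definition pair_structure (L : language) (M N : structure L) (i : M -> N) :
    structure (add_rel L (fun _ : unit => 1%N)) :=
  @expansion L unit (fun=> 1%N) N (fun _ => [set v | range i (v ord0)]).

(* L': the symbols of L together with, for every L(D)-formula phi(x,d), a
   relation symbol R_(phi(x,d)) of arity |x|. *)
Definition shelah_language (L : language) (D : Type) : language :=
  add_rel L (fun s : {n : nat & pformula L D n} => projT1 s).

(* For M inside N through [i] and parameters from D interpreted in N through
   [f], R_(phi(x,d)) is {a in M^x | N |= phi(a,d)}. *)
Definition shelah_structure (L : language) (M N : structure L) (i : M -> N)
    (D : Type) (f : D -> N) : structure (shelah_language L D) :=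
  @expansion L {n : nat & pformula L D n} (fun s => projT1 s) M
    (fun s => [set a | pholds f (projT2 s) (i \o a)]).

Definition shelah_expansion (L : language) (M N : structure L) (i : M -> N) :
    structure (shelah_language L N) :=
  shelah_structure i id.

(* Main.v *)
Require Import Defs.
From HB Require Import structures.
From mathcomp Require Import all_boot all_order all_algebra finmap zify.
From mathcomp Require Import all_classical all_reals all_analysis lra.

(**
  For a measure [mu] on a saturated structure and a small set [A], being
  definable over [A] and finitely satisfiable in [A] is the same as having
  finite nets in [A]: for every formula [phi(x,y)] and [e > 0] some finite
  subset of [A] meets each [phi(x,b)] of measure at least [e] ([has_nets]).
  One direction is compactness of the type space over [A]: the [b] with
  [mu(phi(x,b)) >= e] form a closed set, which the clopen sets [phi(a,y)], with
  [a] in [A], cover ([dfs_nets]).  The other applies nets to the symmetric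
  differences of [phi(x,b)] and [phi(x,b')] ([nets_fs], [nets_dfs]).  So generic
  stability becomes a property of nets, which restricts at once from the
  expanded language L' to L; the content is the passage from L to L'.

  That passage rests on honest definitions.  In a model of the theory of the
  Shelah expansion, each basic relation is locally L-definable: on any finite
  set of points it agrees with an instance of one fixed L-formula, because M is
  an elementary substructure of N and this is expressed by L'-sentences
  ([locally_definable_symbol]).  NIP turns local definability into more: there
  is an L-formula [theta] such that every finite subset of the relation is
  covered by an instance of [theta] contained in the relation
  ([honest_definition]).  Otherwise the finite sets violating this for the
  various [theta], gathered together, carry an ultrafilter containing no
  L-definable subset of the relation; its realizations can be chosen in turn
  inside and outside of the relation, and such an alternating indiscernible
  sequence contradicts NIP ([no_alternation]).  Honest definitions carry local
  definability through quantifiers, so every L'-formula is locally definable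
  ([locally_definable_all_formulas]) and has an honest definition.

  Now let [mu] be an L-measure with nets in [A], let [psi(x,b)] be an
  L'-formula, and let [theta], [theta'] be honest definitions of [psi] and of
  its negation.  Instances of [theta] and [theta'] that cover a net for the
  complements of [theta] or [theta'] leave out a set of small measure, so they
  squeeze [psi(x,b)] between two L-definable sets of nearly the same measure
  ([inner_approx]).  Hence [mu] has one extension, its inner measure
  ([extension_unique], [extension_exists]), and this extension again has nets
  in [A] ([nets_extension]).  Countably many points per formula suffice for all
  the nets, so Loewenheim-Skolem supplies the small elementary substructure in
  the definition of generic stability ([nets_coded], [lowenheim_skolem]).
  Finally the squeezing instance for [b] can be moved to [b'] whenever [b] and
  [b'] have the same L'-type over a set, by saturation, which transfers
  invariance from [mu] to the extension ([invariant_extension]).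
*)

Set Implicit Arguments.
Unset Strict Implicit.
Unset Printing Implicit Defensive.

Import Order.TTheory GRing.Theory Num.Theory.
Import numFieldNormedType.Exports.

Local Open Scope classical_set_scope.
Local Open Scope ring_scope.

Lemma iff_forall (A : Type) (P Q : A -> Prop) :
  (forall a, P a <-> Q a) -> (forall a, P a) <-> (forall a, Q a).
Proof. by move=> PQ; split=> h a; apply/PQ. Qed.

(** * Substitution *)

Section Substitution.
Context (L : language).

Fixpoint subst_term (n m : nat) (s : 'I_n -> term L m) (t : term L n) : term L m :=
  match t with
  | Var i => s i
  | App f ts => App f (fun i => subst_term s (ts i))
  end.

Definition subst_up (n m : nat) (s : 'I_n -> term L m) : 'I_n.+1 -> term L m.+1 :=
  tcons (Var ord0) (fun j => subst_term (fun i => Var (lift ord0 i)) (s j)).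

Fixpoint subst (n : nat) (p : formula L n) : forall m, ('I_n -> term L m) -> formula L m :=
  match p with
  | Equal t u => fun m s => Equal (subst_term s t) (subst_term s u)
  | Rel r ts => fun m s => Rel r (fun i => subst_term s (ts i))
  | Bot => fun m s => Bot
  | Imp p q => fun m s => Imp (subst p s) (subst q s)
  | All p => fun m s => All (subst p (subst_up s))
  end.

Lemma teval_subst (X : structure L) n m (s : 'I_n -> term L m) t (v : 'I_m -> X) :
  teval (subst_term s t) v = teval t (fun i => teval (s i) v).
Proof. by elim: t => //= f ts IH; congr finterp; apply: funext. Qed.

Lemma tcons0 (X : Type) n (a : X) (v : 'I_n -> X) : tcons a v ord0 = a.
Proof. by rewrite /tcons unlift_none. Qed.

Lemma tcons_lift (X : Type) n (a : X) (v : 'I_n -> X) i :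
  tcons a v (lift ord0 i) = v i.
Proof. by rewrite /tcons liftK. Qed.

Lemma holds_subst (X : structure L) n (p : formula L n) m (s : 'I_n -> term L m)
    (v : 'I_m -> X) :
  holds (subst p s) v <-> holds p (fun i => teval (s i) v).
Proof.
elim: p m s v => {n} /= [n t u|n r ts|n|n p IHp q IHq|n p IHp] m s v.
- by rewrite !teval_subst.
- suff -> : (fun i => teval (subst_term s (ts i)) v) =
    (fun i => teval (ts i) (fun j => teval (s j) v)) by [].
  by apply: funext => i; rewrite teval_subst.
- by [].
- by rewrite IHp IHq.
- apply: iff_forall => a; rewrite IHp.
  suff -> : (fun i => teval (subst_up s i) (tcons a v)) =
    tcons a (fun i => teval (s i) v) by [].
  apply: funext => i; case: (unliftP ord0 i) => [j|] ->.
    rewrite /subst_up !tcons_lift teval_subst; congr teval.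
    by apply: funext => k /=; rewrite tcons_lift.
  by rewrite /subst_up !tcons0 /= tcons0.
Qed.

Definition rename n m (r : 'I_n -> 'I_m) (p : formula L n) : formula L m :=
  subst p (fun i => Var (r i)).

Lemma holds_rename (X : structure L) n m (r : 'I_n -> 'I_m) p (v : 'I_m -> X) :
  holds (rename r p) v <-> holds p (v \o r).
Proof. exact: holds_subst. Qed.

End Substitution.

Definition sumv (I J X : Type) (v : I -> X) (w : J -> X) : I + J -> X :=
  fun u => match u with inl i => v i | inr j => w j end.

Definition optv (I X : Type) (y : X) (v : I -> X) : option I -> X :=
  fun u => if u is Some i then v i else y.

Definition ord0_elim (X : Type) (i : 'I_0) : X :=
  match i with Ordinal _ h => match notF h with end end.

(** * Uniformly definable classes *)

(** A property of assignments given on all structures at once, so that the same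
    class can be read in [M], in [N] and in the expansions.  The index type [I]
    of the variables is arbitrary: changing variables is then composition, and
    tuples are joined by sums of index types. *)
Definition class (L : language) (I : Type) : Type :=
  forall Y : structure L, (I -> Y) -> Prop.

Definition udefinable (L : language) (I : Type) (S : class L I) : Prop :=
  exists n (p : formula L n) (r : 'I_n -> I),
    forall (Y : structure L) (v : I -> Y), S Y v <-> holds p (v \o r).

Section Udef.
Context (L : language).

Lemma udefinable_ext I (S S' : class L I) :
  (forall Y v, S Y v <-> S' Y v) -> udefinable S -> udefinable S'.
Proof. by move=> SS [n [p [r H]]]; exists n, p, r => Y v; rewrite -SS. Qed.

Lemma udefinable_holds I n (p : formula L n) (r : 'I_n -> I) :
  udefinable (fun (Y : structure L) (v : I -> Y) => holds p (v \o r)).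
Proof. by exists n, p, r. Qed.

Lemma udefinable_ren I J (g : I -> J) (S : class L I) :
  udefinable S -> udefinable (fun (Y : structure L) (v : J -> Y) => S Y (v \o g)).
Proof. by move=> [n [p [r H]]]; exists n, p, (g \o r) => Y v; rewrite H. Qed.

Lemma udefinable_bot I : udefinable (fun (Y : structure L) (v : I -> Y) => False).
Proof.
by exists 0%N, Bot, (@ord0_elim _).
Qed.

Lemma udefinable_imp I (S1 S2 : class L I) : udefinable S1 -> udefinable S2 ->
  udefinable (fun (Y : structure L) (v : I -> Y) => S1 Y v -> S2 Y v).
Proof.
move=> [n1 [p1 [r1 H1]]] [n2 [p2 [r2 H2]]].
exists (n1 + n2)%N, (Imp (rename (lshift n2) p1) (rename (@rshift n1 n2) p2)).
exists (tcat r1 r2) => Y v /=; rewrite !holds_rename H1 H2.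
have -> : (v \o tcat r1 r2) \o lshift n2 = v \o r1.
  apply: funext => i /=; congr v; rewrite /tcat.
  by rewrite (_ : lshift n2 i = unsplit (inl i))// unsplitK.
have -> // : (v \o tcat r1 r2) \o @rshift n1 n2 = v \o r2.
apply: funext => i /=; congr v; rewrite /tcat.
by rewrite (_ : rshift n1 i = unsplit (inr i))// unsplitK.
Qed.

Lemma udefinable_neg I (S : class L I) : udefinable S ->
  udefinable (fun (Y : structure L) v => ~ S Y v).
Proof. by move=> dS; apply: udefinable_imp dS (udefinable_bot _). Qed.

Lemma udefinable_and I (S1 S2 : class L I) : udefinable S1 -> udefinable S2 ->
  udefinable (fun (Y : structure L) v => S1 Y v /\ S2 Y v).
Proof.
move=> d1 d2.
apply: udefinable_ext (udefinable_neg (udefinable_imp d1 (udefinable_neg d2))) => Y v.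
split=> [h|[h1 h2] h]; last exact: h.
by split; apply: contrapT => n; apply: h => // h1; case: n.
Qed.

Lemma udefinable_or I (S1 S2 : class L I) : udefinable S1 -> udefinable S2 ->
  udefinable (fun (Y : structure L) v => S1 Y v \/ S2 Y v).
Proof.
move=> d1 d2; apply: udefinable_ext (udefinable_imp (udefinable_neg d1) d2) => Y v.
by split=> [h|[]//]; have [|/h] := EM (S1 Y v); [left|right].
Qed.

Lemma udefinable_iff I (S1 S2 : class L I) : udefinable S1 -> udefinable S2 ->
  udefinable (fun (Y : structure L) v => S1 Y v <-> S2 Y v).
Proof. by move=> d1 d2; apply: udefinable_and; apply: udefinable_imp. Qed.

(** Variables that stand for the quantified one become the bound variable; all
    others are kept.  When [I] is empty there is nothing to send the remaining
    slots to, whence the case distinction. *)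
Lemma udefinable_forall1 I (S : class L (option I)) : udefinable S ->
  udefinable (fun (Y : structure L) (v : I -> Y) => forall y : Y, S Y (optv y v)).
Proof.
move=> [n [p [r H]]]; have [[i0 _]|noI] := EM (exists i : I, True).
  pose r0 t := if r t is Some i then i else i0.
  pose s t := if r t is Some _ then lift ord0 t else ord0 : 'I_n.+1.
  exists n, (All (rename s p)), r0 => Y v /=; apply: iff_forall => y.
  rewrite holds_rename H.
  suff -> : tcons y (v \o r0) \o s = optv y v \o r by [].
  apply: funext => t; rewrite /= /s /r0; case E: (r t) => [i|] /=.
    by rewrite tcons_lift /= E.
  by rewrite tcons0.
exists 0%N, (All (rename (fun=> ord0) p)).
exists (@ord0_elim _) => Y v /=.
apply: iff_forall => y; rewrite holds_rename H.
set v1 := _ \o r; set v2 := _ \o (fun=> ord0); suff -> : v1 = v2 by [].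
apply: funext => t; rewrite /v1 /v2 /= tcons0.
by case: (r t) => //= i; case: noI; exists i.
Qed.

Lemma udefinable_forall_ord I k (S : class L (I + 'I_k)) : udefinable S ->
  udefinable (fun (Y : structure L) (v : I -> Y) => forall w : 'I_k -> Y, S Y (sumv v w)).
Proof.
elim: k I S => [|k IH] I S dS.
  have [i0|noI] := pselect (inhabited I); last first.
    case: dS => n [p [r H]].
    have n0 : n = 0%N.
      case: n p r H => // n p r _.
      by case: (r ord0) => [i|[]//]; case: noI.
    subst n; exists 0%N, p, (@ord0_elim _) => Y v.
    have e (u1 u2 : 'I_0 -> Y) : u1 = u2 by apply: funext => -[].
    split=> [h|h w]; last by apply/H; rewrite (e (_ \o r) (v \o @ord0_elim _)).
    have [y] := carrier_inhabited Y.
    by have /H := h (fun=> y); rewrite (e (_ \o r) (v \o @ord0_elim _)).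
  case: i0 => i0.
  pose g (u : I + 'I_0) := match u with inl i => i | inr _ => i0 end.
  have E Y (v : I -> Y) w : sumv v w = v \o g by apply: funext => -[|[]].
  apply: udefinable_ext (udefinable_ren g dS) => Y v.
  by split=> [h w|/(_ (fun=> v i0))]; rewrite E.
pose g (u : I + 'I_k.+1) : option I + 'I_k := match u with
  | inl i => inl (Some i)
  | inr j => if unlift ord0 j is Some j' then inr j' else inl None end.
have := udefinable_forall1 (IH _ _ (udefinable_ren g dS)); apply: udefinable_ext => Y v.
have E y (w : 'I_k -> Y) : sumv (optv y v) w \o g = sumv v (tcons y w).
  by apply: funext => -[i|j] //=; rewrite /tcons; case: unlift.
split=> [h w|h y w]; last by rewrite E; exact: h.
have -> : w = tcons (w ord0) (fun j => w (lift ord0 j)).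
  apply: funext => j; case: (unliftP ord0 j) => [j'|] ->.
    by rewrite tcons_lift.
  by rewrite tcons0.
by rewrite -E; exact: h.
Qed.

Lemma udefinable_forall I (J : finType) (S : class L (I + J)) : udefinable S ->
  udefinable (fun (Y : structure L) (v : I -> Y) => forall w : J -> Y, S Y (sumv v w)).
Proof.
move=> dS; pose g (u : I + J) : I + 'I_#|J| :=
  match u with inl i => inl i | inr j => inr (enum_rank j) end.
have := udefinable_forall_ord (udefinable_ren g dS); apply: udefinable_ext => Y v.
have E w : sumv v (w \o enum_rank) = sumv v w \o g :> (_ -> Y).
  by apply: funext => -[].
split=> h w; last by rewrite -E; exact: h.
have -> : w = (w \o enum_val) \o enum_rank.
  by apply: funext => j /=; rewrite enum_rankK.
by rewrite E; exact: h.
Qed.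

Lemma udefinable_exists I (J : finType) (S : class L (I + J)) : udefinable S ->
  udefinable (fun (Y : structure L) (v : I -> Y) => exists w : J -> Y, S Y (sumv v w)).
Proof.
move=> dS.
apply: udefinable_ext (udefinable_neg (udefinable_forall (udefinable_neg dS))) => Y v.
by rewrite -existsNP; split=> -[w]; exists w => //; apply: contrapT.
Qed.

Lemma udefinable_conj I k (S : 'I_k -> class L I) : (forall j, udefinable (S j)) ->
  udefinable (fun (Y : structure L) (v : I -> Y) => forall j, S j Y v).
Proof.
elim: k S => [|k IH] S dS.
  by apply: udefinable_ext (udefinable_neg (udefinable_bot _)) => Y v; split=> // _ [].
have := udefinable_and (dS ord0) (IH _ (fun j => dS (lift ord0 j))).
apply: udefinable_ext => Y v; split=> [[h0 h] j|h]; last by split=> [|j]; apply: h.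
by case: (unliftP ord0 j) => [j'|] ->.
Qed.

Lemma tcat_l (X : Type) n m (a : 'I_n -> X) (b : 'I_m -> X) i :
  tcat a b (lshift m i) = a i.
Proof. by rewrite /tcat (_ : lshift m i = unsplit (inl i))// unsplitK. Qed.

Lemma tcat_r (X : Type) n m (a : 'I_n -> X) (b : 'I_m -> X) i :
  tcat a b (rshift n i) = b i.
Proof. by rewrite /tcat (_ : rshift n i = unsplit (inr i))// unsplitK. Qed.

Lemma tcatE (X : Type) n m (a : 'I_n -> X) (b : 'I_m -> X) :
  tcat a b = sumv a b \o (@fintype.split n m).
Proof. by []. Qed.

Lemma udefinable_tcat n m (p : formula L (n + m)) :
  udefinable (fun (Y : structure L) (v : 'I_n + 'I_m -> Y) => holds p (v \o @fintype.split n m)).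
Proof. exact: udefinable_holds. Qed.

(** Back to formulas in separated variables.  A slot that [x] does not fill is
    a parameter from [w]; the parameters are indexed by all slots, and those that
    [x] fills get the dummy value [y0]. *)
Lemma udefinable_split n (J : Type) (S : class L ('I_n + J)) : udefinable S ->
  exists m (p : formula L (n + m)) (d : 'I_m -> option J),
    forall (Y : structure L) (w : J -> Y) (y0 : Y) (x : 'I_n -> Y),
      S Y (sumv x w) <-> holds p (tcat x (optv y0 w \o d)).
Proof.
move=> [N [p [r H]]].
pose s (t : 'I_N) : 'I_(n + N) :=
  match r t with inl i => lshift N i | inr _ => rshift n t end.
pose d (t : 'I_N) := match r t with inl _ => None | inr j => Some j end.
exists N, (rename s p), d => Y w y0 x; rewrite H holds_rename.
suff -> : sumv x w \o r = tcat x (optv y0 w \o d) \o s by [].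
apply: funext => t /=; rewrite /s; case E: (r t) => [i|j] /=.
  by rewrite tcat_l.
by rewrite tcat_r /= /d E.
Qed.

(** The parameters are the values of [w] and nothing else, so that their type
    over a set, possibly empty, is controlled by that of [w]. *)
Lemma udefinable_split_fin n (J : finType) (S : class L ('I_n + J)) : udefinable S ->
  exists p : formula L (n + #|J|), forall (Y : structure L) (w : J -> Y) x,
    S Y (sumv x w) <-> holds p (tcat x (w \o enum_val)).
Proof.
move=> [k [p [r H]]].
pose r0 (t : 'I_k) : 'I_(n + #|J|) := match r t with
  | inl u => lshift _ u | inr j => rshift n (enum_rank j) end.
exists (rename r0 p) => Y w x; rewrite holds_rename H.
suff -> : sumv x w \o r = tcat x (w \o enum_val) \o r0 by [].
apply: funext => t; rewrite /r0 /=; case: (r t) => [u|j]; first by rewrite tcat_l.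
by rewrite tcat_r /= enum_rankK.
Qed.

End Udef.

Lemma elementary_udefinable (L : language) (X Y : structure L) (f : X -> Y) I (S : class L I)
    (v : I -> X) :
  elementary_embedding f -> udefinable S -> S X v <-> S Y (f \o v).
Proof. by move=> fe [n [p [r H]]]; rewrite !H; exact: fe. Qed.

Lemma udefinable_lift (L : language) (P : Type) (ar : P -> nat) I (S : class L I) :
  udefinable S ->
  udefinable (fun (Y : structure (add_rel L ar)) (v : I -> Y) => S (reduct Y) v).
Proof.
move=> [n [p [r H]]]; exists n, (lift_formula ar p), r => Y v.
by rewrite H holds_lift.
Qed.

(** * Definable sets and Keisler measures *)

Section Definable.
Context (L : language) (X : structure L) (n : nat).
Implicit Types D E : set ('I_n -> X).

Lemma definable_udefinable (J : Type) (S : class L ('I_n + J)) (w : J -> X) :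
  udefinable S -> definable [set x : 'I_n -> X | S X (sumv x w)].
Proof.
move=> /udefinable_split [m [p [d H]]]; have [y0] := carrier_inhabited X.
exists (PFormula p (optv y0 w \o d)); apply/seteqP.
by split=> x /=; rewrite (H _ _ y0).
Qed.

(** The parameters of a definable set become variables indexed by the structure
    itself, which puts two definable sets over common variables. *)
Lemma definable_class D : definable D ->
  exists S : class L ('I_n + X), udefinable S /\ D = [set x | S X (sumv x id)].
Proof.
move=> [[m p b] ->].
exists (fun Y v => holds p (v \o (fun u => match fintype.split u with
  inl i => inl i | inr j => inr (b j) end))); split; first exact: udefinable_holds.
apply/seteqP; split=> x /=; rewrite /pholds /=; set v1 := tcat _ _; set v2 := _ \o _.
  by rewrite (_ : v1 = v2)//; apply: funext => u; rewrite /v1 /v2 /tcat/=; case: fintype.split.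
by rewrite (_ : v1 = v2)//; apply: funext => u; rewrite /v1 /v2 /tcat/=; case: fintype.split.
Qed.

Lemma definableC D : definable D -> definable (~` D).
Proof.
by move=> /definable_class [S [dS ->]]; exact: definable_udefinable (udefinable_neg dS).
Qed.

Lemma definableI D E : definable D -> definable E -> definable (D `&` E).
Proof.
move=> /definable_class [S [dS ->]] /definable_class [S' [dS' ->]].
exact: definable_udefinable (udefinable_and dS dS').
Qed.

Lemma definableU D E : definable D -> definable E -> definable (D `|` E).
Proof.
move=> dD dE; rewrite -(setCK (_ `|` _)) setCU.
by apply/definableC/definableI; apply: definableC.
Qed.

Lemma definable0 : definable (@set0 ('I_n -> X)).
Proof.
have := definable_udefinable (id : X -> X) (udefinable_bot L ('I_n + X)).
by rewrite (_ : [set _ | _] = set0).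
Qed.

Lemma definableT : definable [set: 'I_n -> X].
Proof. by rewrite -setC0; apply/definableC/definable0. Qed.

End Definable.

Section Measure.
Context (R : realType) (L : language) (X : structure L) (n : nat).
Implicit Types (D E : set ('I_n -> X)) (mu : keisler R X n).

(** [mu] as a function of plain sets, so that definability proofs stay out of
    the computations. *)
Definition mass mu D : R :=
  if pselect (definable D) is left h then mu (DefinableSet h) else 0.

Lemma mass_dset mu (D : definable_set X n) : mass mu D = mu D.
Proof.
rewrite /mass; case: pselect => [h|]; last by case: D.
by case: D h => D d h; congr (mu (DefinableSet _)); exact: Prop_irrelevance.
Qed.

Lemma mass_instance mu m (p : formula L (n + m)) b :
  mu (instance_set p b) = mass mu [set x | holds p (tcat x b)].
Proof. by rewrite -mass_dset. Qed.

Lemma keisler_ext mu nu : (forall D, definable D -> mass mu D = mass nu D) -> mu = nu.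
Proof.
move=> e; have {}e : mu =1 nu :> (_ -> _) by move=> D; rewrite -!mass_dset e//; case: D.
case: mu nu e => [f f1 f2 f3] [g g1 g2 g3] /= /funext e.
by subst g; congr Keisler; exact: Prop_irrelevance.
Qed.

Lemma mass_ge0 mu D : 0 <= mass mu D.
Proof. by rewrite /mass; case: pselect => // ?; exact: keisler_ge0. Qed.

Lemma massT mu : mass mu setT = 1.
Proof.
rewrite /mass; case: pselect => [h|]; last by case; exact: definableT.
exact: keisler_setT.
Qed.

Lemma massU mu D E : definable D -> definable E -> D `&` E = set0 ->
  mass mu (D `|` E) = mass mu D + mass mu E.
Proof.
move=> dD dE DE; rewrite /mass.
case: pselect => [h1|//]; last by case; exact: definableU.
case: pselect => [h2|//]; case: pselect => [h3|//].
exact: keisler_setU.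
Qed.

Lemma le_mass mu D E : definable D -> definable E -> D `<=` E -> mass mu D <= mass mu E.
Proof.
move=> dD dE DE; have -> : E = D `|` (E `&` ~` D).
  apply/seteqP; split=> x /=; last by move=> [/DE|[]].
  by have [Dx|nDx] := EM (D x); [left|right].
rewrite massU//; [by rewrite lerDl mass_ge0|exact/definableI/definableC|].
by rewrite setICA setICr setI0.
Qed.

Lemma mass_le1 mu D : mass mu D <= 1.
Proof.
have [dD|dD] := pselect (definable D).
  by rewrite -(massT mu) le_mass//; exact: definableT.
by rewrite /mass; case: pselect.
Qed.

Lemma mass_leU mu D E : definable D -> definable E ->
  mass mu (D `|` E) <= mass mu D + mass mu E.
Proof.
move=> dD dE; rewrite (_ : D `|` E = D `|` (E `&` ~` D)).
  rewrite massU//; [|exact/definableI/definableC|by rewrite setICA setICr setI0].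
  by rewrite lerD2l le_mass//; exact/definableI/definableC.
apply/seteqP; split=> x /=; last by move=> [|[]]; [left|right].
by have [Dx|nDx] := EM (D x); [left|move=> [//|Ex]; right].
Qed.

End Measure.

(** * Saturation and nets *)

Section Saturation.
Context (L : language) (X : structure L) (A : set X).
Hypothesis satA : realizes_types_over A.

(** The formulas over [A] that hold on a set of the ultrafilter form a complete
    type, finitely satisfiable because ultrafilters are closed under finite
    intersections.  Generating filters in place of types spares conjunctions of
    formulas. *)
Lemma ultra_realized m (U : set_system ('I_m -> X)) : UltraFilter U ->
  exists b, forall psi : pformula L A m,
    pholds set_val psi b <-> U [set y | pholds set_val psi y].
Proof.
move=> UU; pose p : set (pformula L A m) :=
  [set psi | U [set y | pholds set_val psi y]].
have [|b pb] := satA (p := p).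
  move=> q qfin qp.
  have : U (\bigcap_(psi in q) [set y | pholds set_val psi y]).
    have [r rq] : exists r : {fset classicType (pformula L A m)},
        (q : set (classicType _)) = [set` r] by apply/finite_fsetP.
    rewrite (_ : q = [set` r]); last exact: rq.
    apply: (@filter_bigI _ (classicType (pformula L A m)) r
      (fun psi => [set y | pholds set_val psi y])) => psi psir.
    by apply: qp; rewrite (_ : q = [set` r]).
  by move=> /filter_ex [b hb]; exists b => psi /hb.
exists b => psi; split; last exact: pb.
move=> h; have [//|] := in_ultra_setVsetC [set y | pholds set_val psi y] UU.
by move=> /(pb (pneg psi)) /(_ h).
Qed.

Lemma ultra_realized_udefinable m (U : set_system ('I_m -> X)) : UltraFilter U ->
  A !=set0 ->
  exists b, forall J (S : class L ('I_m + J)) (w : J -> X), udefinable S ->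
    (forall j, A (w j)) ->
    S X (sumv b w) <-> U [set y | S X (sumv y w)].
Proof.
move=> UU [a0 Aa0]; have [b hb] := ultra_realized UU.
exists b => J S w /udefinable_split [k [p [d H]]] Aw.
pose w' j : A := SigSub (mem_set (Aw j)).
pose a0' : A := SigSub (mem_set Aa0).
have E : set_val \o (optv a0' w' \o d) = optv a0 w \o d.
  by apply: funext => t /=; case: (d t).
have -> : [set y | S X (sumv y w)] =
    [set y | pholds set_val (PFormula p (optv a0' w' \o d)) y].
  by apply/seteqP; split=> y /=; rewrite /pholds /= E (H _ _ a0).
by rewrite -hb /pholds /= E (H _ _ a0).
Qed.

End Saturation.

Section Nets.
Context (R : realType) (L : language) (X : structure L) (n : nat).
Implicit Types (mu : keisler R X n) (A : set X).

(** Finite epsilon-nets, in the sense of combinatorial geometry, for all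
    uniformly definable families and with points in [A]. *)
Definition has_nets mu A : Prop :=
  forall J (S : class L ('I_n + J)), udefinable S -> forall e : R, 0 < e ->
  exists k (a : 'I_k -> 'I_n -> X), (forall j i, A (a j i)) /\
  forall w : J -> X, e <= mass mu [set x | S X (sumv x w)] ->
  exists j, S X (sumv (a j) w).

Lemma nets_sub mu A B : A `<=` B -> has_nets mu A -> has_nets mu B.
Proof.
move=> AB h J S dS e e0; have [k [a [Aa ha]]] := h J S dS e e0.
by exists k, a; split=> // j i; exact: AB.
Qed.

Lemma near_open_type A m (p : type_space A m) (psi : pformula L A m) :
  type_mem p psi -> \forall q \near p, type_mem q psi.
Proof.
move=> ppsi; apply: (@open_nbhs_nbhs _ p [set q : type_space A m | type_mem q psi]).
split => //; pose V := [set q : type_space A m | type_mem q psi].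
exists [set V]; last by rewrite bigcup_set1.
move=> _ ->; exists [fset V]%fset.
  by move=> W; rewrite in_fset1 => /eqP ->; apply: mem_set; exists psi.
by rewrite set_fset1 bigcap_set1.
Qed.

(** A neighbourhood in the logic topology contains a finite intersection of
    subbasic sets. *)
Lemma nbhs_typeP A m (p : type_space A m) (V : set (type_space A m)) :
  nbhs p V -> exists k (psi : 'I_k -> pformula L A m),
    (forall j, type_mem p (psi j)) /\
    forall q : type_space A m, (forall j, type_mem q (psi j)) -> V q.
Proof.
rewrite nbhsE => -[W [[D' sD' <-] [B D'B Bp]] WV].
have [E ED EB] := sD' _ D'B.
have {WV} BV : B `<=` V by move=> q Bq; apply: WV; exists B.
have Ep V' : V' \in E -> exists psi : pformula L A m,
    V' = [set q : type_space A m | type_mem q psi].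
  by move=> /ED /set_mem.
suff [k [psi [h1 h2]]] : exists k (psi : 'I_k -> pformula L A m),
    (forall j, type_mem p (psi j)) /\
    forall q : type_space A m, (forall j, type_mem q (psi j)) ->
    forall V', V' \in E -> V' q.
  exists k, psi; split=> // q hq; apply: BV; rewrite -EB => V'; exact: h2.
have {EB Bp B D'B BV} Ep1 : forall V', V' \in E -> V' p.
  by rewrite -EB in Bp => V' /Bp.
have {Ep Ep1} : forall V', V' \in enum_fset E -> V' p /\
    exists psi : pformula L A m, V' = [set q : type_space A m | type_mem q psi].
  by move=> V' V'E; split; [exact: Ep1|exact: Ep].
suff H (l : seq (set (type_space A m))) : (forall V', V' \in l -> V' p /\
    exists psi : pformula L A m, V' = [set q : type_space A m | type_mem q psi]) ->
  exists k (psi : 'I_k -> pformula L A m),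
    (forall j, type_mem p (psi j)) /\
    forall q : type_space A m, (forall j, type_mem q (psi j)) ->
    forall V', V' \in l -> V' q by exact: H.
elim: l => [_|V' l IH Vl]; first by exists 0%N, (@ord0_elim _); split=> // -[].
have [|k [psi [h1 h2]]] := IH; first by move=> Z Zl; apply: Vl; rewrite inE Zl orbT.
have [|V'p [psi0 psi0E]] := Vl V'; first by rewrite inE eqxx.
exists k.+1, (tcons psi0 psi); split.
  move=> j; rewrite /tcons; case: unlift => [j'|]; first exact: h1.
  by move: V'p; rewrite psi0E.
move=> q hq Z; rewrite inE => /orP[/eqP ->|].
  by rewrite psi0E /=; have := hq ord0; rewrite tcons0.
by apply: h2 => j; have := hq (lift ord0 j); rewrite tcons_lift.
Qed.

Lemma swap_instance A m (p : formula L (n + m)) (a : 'I_n -> X) :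
  (forall i, A (a i)) -> exists psi : pformula L A m,
    forall b, pholds set_val psi b <-> holds p (tcat a b).
Proof.
move=> Aa; pose sw (u : 'I_(n + m)) := match fintype.split u with
  | inl i => rshift m i | inr j => lshift n j end.
exists (PFormula (rename sw p) (fun i => SigSub (mem_set (Aa i)) : A)) => b.
rewrite /pholds /= holds_rename; set v1 := _ \o _.
rewrite (_ : v1 = tcat a b)//; apply: funext => u; rewrite /v1 /sw [RHS]/tcat /=.
by case: fintype.split => w; rewrite ?tcat_l ?tcat_r.
Qed.

(** Compactness.  If no finite subset of [A] meets all instances of measure at
    least [e], the parameters [b] of large instances missed by each finite subset
    generate a proper filter.  A realization [b] of an ultrafilter above it has
    an instance missed by all of [A]; by continuity of the measure on types its
    measure is still at least [e], against finite satisfiability. *)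
Lemma dfs_nets mu A : realizes_types_over A ->
  definable_over mu A -> finitely_satisfiable_in mu A -> has_nets mu A.
Proof.
move=> satA [_ defA] fsA J S dS e e0.
have [m [p [d H]]] := udefinable_split dS; have [y0] := carrier_inhabited X.
suff [k [a [Aa ha]]] : exists k (a : 'I_k -> 'I_n -> X), (forall j i, A (a j i)) /\
  forall b, e <= mu (instance_set p b) -> exists j, holds p (tcat (a j) b).
  exists k, a; split=> // w; rewrite (_ : [set x | _] =
    [set x | holds p (tcat x (optv y0 w \o d))]).
    by rewrite -mass_instance => /ha [j]; rewrite -H; exists j.
  by apply/seteqP; split=> x /=; rewrite (H _ _ y0).
apply: contrapT => noa.
pose G k (a : 'I_k -> 'I_n -> X) := [set b : 'I_m -> X |
  e <= mu (instance_set p b) /\ forall j, ~ holds p (tcat (a j) b)].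
pose F : set_system ('I_m -> X) := [set V | exists k (a : 'I_k -> 'I_n -> X),
  (forall j i, A (a j i)) /\ G k a `<=` V].
have FF : ProperFilter F.
  split.
    move=> [k [a [Aa Ga]]]; apply: noa; exists k, a; split=> // b eb.
    by apply: contrapT => nj; apply: (Ga b); split=> // j hj; apply: nj; exists j.
  split.
  - by exists 0%N, (@ord0_elim _); split=> // -[].
  - move=> V1 V2 [k1 [a1 [Aa1 G1]]] [k2 [a2 [Aa2 G2]]].
    exists (k1 + k2)%N, (tcat a1 a2); split.
      by move=> j; rewrite /tcat; case: fintype.split.
    move=> b [eb hb]; split; [apply: G1|apply: G2]; split=> // j.
      by have := hb (lshift _ j); rewrite tcat_l.
    by have := hb (rshift _ j); rewrite tcat_r.
  - by move=> V1 V2 V12 [k [a [Aa Ga]]]; exists k, a; split=> // b /Ga /V12.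
have [U [UU FU]] := ultraFilterLemma FF.
have [b hb] := ultra_realized satA UU.
have ngood a : (forall i, A (a i)) -> ~ holds p (tcat a b).
  move=> Aa.
  have [psi E] := swap_instance p Aa; have E' : pholds set_val (pneg psi) b.
    apply/hb/FU; exists 1%N, (fun _ => a); split=> // y [_ hy] /E.
    exact: (hy ord0).
  by move/E; exact: E'.
have eb : e <= mu (instance_set p b).
  have [f [cf fE]] := defA m p; rewrite leNgt; apply/negP => be.
  have : \forall q \near tp A b, f q < e.
    have : f (tp A b) < e by rewrite fE.
    by move/lt_nbhsl; exact: (cf (tp A b)).
  move=> /nbhs_typeP [k [psi [h1 h2]]].
  have : U [set y | forall j, pholds set_val (psi j) y].
    by apply: filter_forall => j; apply/hb; exact: h1.
  have : U (G 0%N (@ord0_elim _)).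
    by apply: FU; exists 0%N, (@ord0_elim _); split=> // -[].
  move=> U1 /(filterI U1) /filter_ex [y [[ey _] hy]].
  by have := h2 (tp A y) hy; rewrite fE ltNge ey.
have [a [Aa pa]] := fsA (instance_set p b) (lt_le_trans e0 eb).
exact: ngood pa.
Qed.

Lemma nets_fs mu A : has_nets mu A -> finitely_satisfiable_in mu A.
Proof.
move=> h D D0; have := mass_dset mu D; case: D D0 => D [[m p b] DE] /= D0 prD.
have [k [a [Aa ha]]] := h _ _ (udefinable_tcat p) _ D0.
have E : [set x | holds p (sumv x b \o @fintype.split n m)] = D by rewrite DE.
have [|j pj] := ha b; first by rewrite E prD.
by exists (a j); split=> //=; rewrite -E.
Qed.

(** A net for the symmetric differences of two instances: if [b] and [b'] define
    the same subset of the net, the difference is not hit, hence small. *)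
Lemma nets_close mu A m (p : formula L (n + m)) (e : R) : has_nets mu A -> 0 < e ->
  exists k (a : 'I_k -> 'I_n -> X), (forall j i, A (a j i)) /\
  forall b b' : 'I_m -> X,
    (forall j, holds p (tcat (a j) b) <-> holds p (tcat (a j) b')) ->
    `|mu (instance_set p b) - mu (instance_set p b')| < e.
Proof.
move=> h e0.
pose q (b : bool) (u : 'I_(n + m)) : 'I_n + ('I_m + 'I_m) :=
  match fintype.split u with
  | inl i => inl i | inr j => inr (if b then inl j else inr j) end.
pose S (Y : structure L) (v : 'I_n + ('I_m + 'I_m) -> Y) :=
  ~ (holds p (v \o q true) <-> holds p (v \o q false)).
have dS : udefinable S by apply/udefinable_neg/udefinable_iff; exact: udefinable_holds.
have [k [a [Aa ha]]] := h _ _ dS _ e0; exists k, a; split=> // b b' bb'.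
have E c x : sumv x (sumv b b') \o q c = tcat x (if c then b else b').
  by apply: funext => u; rewrite /q/= /tcat; case: fintype.split => //; case: c.
pose D c := [set x | holds p (tcat x (if c then b else b'))].
have dD c : definable (D c) by exists (PFormula p (if c then b else b')).
have dSb : definable [set x | S X (sumv x (sumv b b'))] by exact: definable_udefinable.
have {ha} lte : mass mu [set x | S X (sumv x (sumv b b'))] < e.
  rewrite ltNge; apply/negP => /ha [j]; rewrite /S !E => n0; apply: n0.
  exact: bb'.
have sub c : mass mu (D c) <= mass mu (D (~~ c)) + mass mu [set x | S X (sumv x (sumv b b'))].
  apply: le_trans (mass_leU _ _ _) => //; apply: le_mass => //; first exact: definableU.
  move=> x Dx; have [Dx'|Dx'] := EM (D (~~ c) x); [by left|right].
  by rewrite /= /S !E => -[h1 h2]; apply: Dx'; case: c Dx; [exact: h1|exact: h2].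
have := sub true; have := sub false; rewrite !mass_instance /=.
rewrite -/(D true) -/(D false) => s1 s2; rewrite ltr_norml; lra.
Qed.

(** By saturation a type over [A] is the type of some [b], and its value is the
    measure of the instance at [b].  Types close to it decide membership of
    finitely many points of [A] in the same way, so [nets_close] gives
    continuity. *)
Lemma nets_dfs mu A : realizes_types_over A -> has_nets mu A -> definable_over mu A.
Proof.
move=> satA h; have inv m (p : formula L (n + m)) (b b' : 'I_m -> X) :
    (forall k (a : 'I_k -> 'I_n -> X), (forall j i, A (a j i)) -> forall j,
      holds p (tcat (a j) b) <-> holds p (tcat (a j) b')) ->
    mu (instance_set p b) = mu (instance_set p b').
  move=> bb'; apply/eqP; rewrite -subr_eq0 -normr_le0; apply/ler_addgt0Pr => e e0.
  have [k [a [Aa ha]]] := nets_close p h e0.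
  by rewrite add0r ltW// ha// => j; exact: bb'.
split=> m p.
  move=> b b' /(congr1 (@type_mem _ _ _ _)) E.
  apply: inv => k a Aa j; have [psi H] := swap_instance p (Aa j).
  by rewrite -!H; have /= := congr1 (fun q => q psi) E; rewrite /tp_mem /= => ->.
have real (q : type_space A m) : exists b, forall psi, type_mem q psi <-> pholds set_val psi b.
  have [b hb] := satA _ _ (@type_finsat _ _ _ _ q); exists b => psi; split; first exact: hb.
  by move=> b_psi; have [//|/hb /(_ b_psi)] := type_complete q psi.
have [f hf] := choice real.
exists (fun q => mu (instance_set p (f q))); split; last first.
  move=> b; apply: inv => k a Aa j; have [psi H] := swap_instance p (Aa j).
  by rewrite -!H -hf.
move=> q; have FF : Filter (nbhs q) := nbhs_filter q.
apply/(@cvgrPdist_lt _ _ _ (nbhs q) FF) => e e0.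
have [k [a [Aa ha]]] := nets_close p h e0.
suff : \forall q' \near q, forall j : 'I_k,
    holds p (tcat (a j) (f q)) <-> holds p (tcat (a j) (f q')).
  by apply: filterS => q' hq'; exact: ha.
apply: (@filter_forall _ _ _ (nbhs q) FF) => j; have [psi H] := swap_instance p (Aa j).
have [qpsi|qpsi] := type_complete q psi; apply: filterS (near_open_type qpsi) => q' q'psi;
  rewrite -!H; move: q'psi qpsi; rewrite !hf //.
by move=> h1 h2; split=> [/h2|/h1].
Qed.

End Nets.

(** * Sets no larger than the set of formulas *)

(** The only cardinal arithmetic needed is that the type of all formulas absorbs
    products with itself and with the natural numbers.  This is proved by coding
    directly: numbers become iterated negations, and two formulas are paired by
    an implication of their universal closures, accompanied by the numbers of
    quantifiers to strip in order to recover them. *)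

Section Coding.
Context (L : language).
Let F : Type := {n : nat & formula L n}.

Fixpoint depth n (p : formula L n) : nat := if p is Imp q _ then (depth q).+1 else 0%N.

Fixpoint close_all n : formula L n -> formula L 0 :=
  if n is k.+1 then fun p => close_all (All p) else id.

Definition strip_all (c : F) : F :=
  match c with existT n p => match p with
    | All q => existT _ n.+1 q | _ => c end end.

Lemma depth_negs n k : depth (iter k (@Neg L n) Bot) = k.
Proof. by elim: k => //= k ->. Qed.

Lemma iter_strip_all n (p : formula L n) :
  iter n strip_all (existT _ 0%N (close_all p)) = existT _ n p.
Proof. by elim: n p => //= n IH p; rewrite IH. Qed.

Definition decode (c : F) : F * F := match c with existT n p => match p with
  | Imp (Imp a b) (Imp u v) =>
     (iter (depth u) strip_all (existT _ n a), iter (depth v) strip_all (existT _ n b))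
  | _ => (c, c) end end.

Lemma decode_surj (d : F * F) : exists c, decode c = d.
Proof.
case: d => -[n p] [m q].
exists (existT _ 0%N (Imp (Imp (close_all p) (close_all q))
  (Imp (iter n (@Neg L 0) Bot) (iter m (@Neg L 0) Bot)))) => /=.
by rewrite !depth_negs !iter_strip_all.
Qed.

Definition covered (T : Type) : Prop := exists s : F -> T, forall t, exists c, s c = t.

Lemma covered_self : covered F. Proof. by exists id => t; exists t. Qed.

Lemma covered_nat : covered nat.
Proof.
exists (fun c => depth (projT2 c)) => k.
by exists (existT _ 0%N (iter k (@Neg L 0) Bot)); rewrite depth_negs.
Qed.

Lemma covered_prod (T U : Type) : covered T -> covered U -> covered (T * U).
Proof.
move=> [s hs] [r hr]; exists (fun c => (s (decode c).1, r (decode c).2)) => -[t u].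
have [[c ct] [d du]] := (hs t, hr u); have [b bE] := decode_surj (c, d).
by exists b; rewrite bE /= ct du.
Qed.

Definition code_nth (c : F) (i : nat) : F := (decode (iter i (fun d => (decode d).2) c)).1.

Lemma code_nth_surj n (t : nat -> F) : exists c, forall i, (i < n)%N -> code_nth c i = t i.
Proof.
elim: n t => [|n IH] t; first by exists (t 0%N).
have [c hc] := IH (t \o S); have [d dE] := decode_surj (t 0%N, c).
exists d => -[|i] lin; first by rewrite /code_nth /= dE.
by rewrite /code_nth iterSr dE; exact: hc.
Qed.

Definition coded (X : Type) (A : set X) : Prop := exists g : F -> X, A `<=` range g.

Lemma coded_card (X : Type) (A : set X) : coded A -> (A #<= [set: F])%card.
Proof.
move=> [g Ag]; apply: card_le_trans (card_image_le g _).
exact: subset_card_le.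
Qed.

Lemma coded_sub (X : Type) (A B : set X) : A `<=` B -> coded B -> coded A.
Proof. by move=> AB [g Bg]; exists g => x /AB /Bg. Qed.

Lemma coded_range (X T : Type) (h : T -> X) : covered T -> coded (range h).
Proof.
move=> [s hs]; exists (h \o s) => _ [t _ <-].
by have [c ct] := hs t; exists c => //=; rewrite ct.
Qed.

Lemma codedU (X : Type) (A B : set X) : coded A -> coded B -> coded (A `|` B).
Proof.
move=> [g Ag] [h Bh].
have := coded_range (fun u : F * nat => if u.2 == 0%N then g u.1 else h u.1)
  (covered_prod covered_self covered_nat).
apply: coded_sub => x [/Ag [c _ <-]|/Bh [c _ <-]].
  by exists (c, 0%N).
by exists (c, 1%N).
Qed.

Lemma coded_seq (X : Type) (x0 : X) m (v : 'I_m -> X) : coded (range v).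
Proof.
have := coded_range (fun k => if insub k is Some i then v i else x0) covered_nat.
by apply: coded_sub => _ [i _ <-]; exists (i : nat) => //; rewrite valK.
Qed.

Lemma small_coded (K X : Type) (A : set X) : small K [set: F] -> coded A -> small K A.
Proof.
move=> [FK nKF] /coded_card AF; split; first exact: card_le_trans FK.
by move=> KA; apply: nKF; exact: card_le_trans AF.
Qed.

End Coding.

(** A formula and a number [m] code a formula in [n + m] variables whenever the
    number of variables is right. *)
Lemma covered_shift (L : language) n : covered L {m : nat & formula L (n + m)}.
Proof.
pose s (u : {N : nat & formula L N} * nat) : {m : nat & formula L (n + m)} :=
  match u with (existT N p, m) => match @eqP _ N (n + m)%N with
    | ReflectT e => existT _ m (ecast N (formula L N) e p)
    | _ => existT _ 0%N Bot end end.
have [g hg] := covered_prod (covered_self L) (covered_nat L).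
exists (s \o g) => -[m p]; have [c cE] := hg (existT _ (n + m)%N p, m).
exists c; rewrite /= cE /s; case: eqP => // e.
by rewrite (eq_axiomK e).
Qed.

(** Hilbert's hotel: along a sequence [g] of distinct points of [A], the first
    [m] are sent to the new points and the others are shifted back by [m]. *)
Lemma card_setU_finite (X : Type) (A : set X) m (v : 'I_m -> X) : infinite_set A ->
  (A `|` range v #<= A)%card.
Proof.
move=> /infiniteP /card_leP [f].
pose g (k : nat) : X := set_val (f (SigSub (mem_set (I : [set: nat] k)))).
have gA k : A (g k) by apply: set_valP.
have ginj : injective g.
  move=> k l /val_inj e.
  have := 'inj_f; move=> /(_ _ _ (mem_set I) (mem_set I) e) /(congr1 val) //.
have [x0] : inhabited X by exists; exact: g 0%N.
pose h (x : X) : X := match pselect (exists k, g k = x) with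
  | left e => let k := sval (cid e) in
     if insub k is Some j then v j else g (k - m)%N
  | right _ => x end.
have hg k : h (g k) = if insub k is Some j then v j else g (k - m)%N.
  rewrite /h; case: pselect => [e|[]]; last by exists k.
  by case: cid => l /= /ginj ->.
apply: card_le_trans (card_image_le h A); apply: subset_card_le => x [Ax|[j _ <-]].
  have [[k kx]|nk] := EM (exists k, g k = x).
    exists (g (k + m)%N) => //; rewrite hg insubF ?addnK//.
    by rewrite ltnNge leq_addl.
  by exists x => //; rewrite /h; case: pselect.
by exists (g j) => //; rewrite hg valK.
Qed.

Lemma small_setU_finite (L : language) (K X : Type) (A : set X) m (v : 'I_m -> X) :
  small K [set: {n : nat & formula L n}] -> small K A -> small K (A `|` range v).
Proof.
move=> [FK nKF] [AK nKA]; have [fA|iA] := pselect (finite_set A); last first.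
  have := card_setU_finite v iA => h; split; first exact: card_le_trans AK.
  by move=> /card_le_trans /(_ h).
have natF : ([set: nat] #<= [set: {n : nat & formula L n}])%card.
  have : coded L [set: nat] by have := coded_range id (covered_nat L); rewrite image_id.
  by move/coded_card.
have fU : finite_set (A `|` range v) by rewrite finite_setU; split=> //; exact: finite_image.
split.
  apply: (@card_le_trans _ _ _ [set: nat]); first exact: finite_set_countable.
  exact: card_le_trans natF FK.
move=> /card_le_finite /(_ fU) fK.
by have /finite_setPn := fK; apply; exact: card_le_trans natF FK.
Qed.

(** * Downward Loewenheim-Skolem *)

Section Skolem.
Context (L : language) (X : structure L).

Definition witnessed (A : set X) : Prop :=
  forall n (p : formula L n.+1) (v : 'I_n -> X), (forall i, A (v i)) ->
  (exists y, holds p (tcons y v)) -> exists y, A y /\ holds p (tcons y v).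

Lemma tarski_vaught (A : set X) : witnessed A -> elementary_substructure A.
Proof.
move=> wA.
have fA (f : Defs.fsym L) (v : 'I_(farity f) -> {x | A x}) : A (finterp f (fun i => sval (v i))).
  have [|y [Ay]] := wA _ (Equal (Var ord0) (App f (fun i => Var (lift ord0 i))))
    (fun i => sval (v i)) (fun i => proj2_sig (v i)).
    by exists (finterp f (fun i => sval (v i))) => /=; rewrite tcons0; congr finterp;
      apply: funext => i; rewrite tcons_lift.
  rewrite /= tcons0 => yE; move: Ay; rewrite yE; congr (A (finterp _ _)).
  by apply: funext => i; rewrite tcons_lift.
have inhA : inhabited {x | A x}.
  have [x0] := carrier_inhabited X.
  have [||y [Ay _]] := wA _ (Neg Bot) (@ord0_elim X); first by move=> [].
    by exists x0.
  by exists; exists y.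
pose S := @Structure L {x | A x} inhA
  (fun f v => exist A (finterp f (fun i => sval (v i))) (@fA f v))
  (fun r v => rinterp r (fun i => sval (v i))).
exists S, (@sval X A); split; last first.
  by apply/seteqP; split=> [_ [[x Ax] _ <-]//|x Ax]; exists (exist A x Ax).
have ev n (t : term L n) (v : 'I_n -> S) : sval (teval t v) = teval t (sval \o v).
  by elim: t => //= f ts IH; congr finterp; apply: funext => i; exact: IH.
move=> n p; elim: p => {n} [n t u|n r ts|n|n p IHp q IHq|n p IHp] v /=.
- rewrite -!ev; split=> [-> //|]; case: (teval t v) (teval u v) => [x Ax] [y Ay] /= xy.
  by subst y; congr exist; exact: Prop_irrelevance.
- suff -> : (fun i => sval (teval (ts i) v)) = (fun i => teval (ts i) (sval \o v)) by [].
  by apply: funext => i; rewrite ev.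
- by [].
- by rewrite IHp IHq.
- have E (a : S) : tcons (sval a) (sval \o v) = sval \o tcons a v.
    by apply: funext => i; rewrite /tcons /=; case: unlift.
  split=> [h a|h a]; last by rewrite IHp -E.
  apply: contrapT => na; have [||y [Ay]] := wA _ (Neg p) (sval \o v).
  + by move=> i /=; case: (v i).
  + by exists a.
  + by move: (h (exist A y Ay)); rewrite IHp -E /= => hy; case.
Qed.

Lemma lowenheim_skolem (A : set X) : coded L A ->
  exists B : set X, [/\ A `<=` B, coded L B & elementary_substructure B].
Proof.
move=> [g Ag]; pose F := {n : nat & formula L n}.
have [x0] := carrier_inhabited X.
have wit n (p : formula L n.+1) (v : 'I_n -> X) : exists y,
    (exists y', holds p (tcons y' v)) -> holds p (tcons y v).
  by have [[y py]|h] := EM (exists y', holds p (tcons y' v)); [exists y|exists x0 => /h].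
pose W n p v := sval (cid (@wit n p v)).
pose wcode (c : F) (u : nat -> X) : X := match c with
  | existT n p => match n return formula L n -> X with
    | 0 => fun=> x0 | k.+1 => fun p => W k p (fun i => u i) end p end.
(* A code of depth zero in its first half repeats an old element, so that the
   stages increase; any other code asks for a witness of a formula at a tuple of
   old elements. *)
pose step (h : F -> X) (c : F) : X :=
  let: (t, d) := decode c in if depth (projT2 t) == 0%N then h d else
  let: (e, s) := decode d in wcode e (fun i => h (code_nth s i)).
pose G k := iter k step g.
have G1 k : range (G k) `<=` range (G k.+1).
  move=> _ [c _ <-]; have [t tE] := decode_surj (existT (formula L) 0%N Bot, c).
  by exists t => //=; rewrite /step tE.
have Gle k k' : (k <= k')%N -> range (G k) `<=` range (G k').
  move=> /subnK <-; elim: (k' - k)%N => // j IH x /IH; exact: G1.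
exists (range (fun u : nat * F => G u.1 u.2)); split.
- by move=> x /Ag [c _ <-]; exists (0%N, c).
- exact/coded_range/covered_prod/covered_self/covered_nat.
apply: tarski_vaught => n p v Av exy.
have {Av} /choice [c hc] : forall i, exists u : nat * F, G u.1 u.2 = v i.
  by move=> i; have [u _ uE] := Av i; exists u.
(* a single stage contains the whole tuple *)
pose k := (\max_(i < n) (c i).1)%N.
have {hc} /choice [c' hc] : forall i, exists d : F, G k d = v i.
  move=> i; have : range (G (c i).1) (v i) by exists (c i).2 => //; exact: hc.
  by move/(Gle _ k (leq_bigmax (F := fun i => (c i).1) i)) => [d _ dE]; exists d.
have [s hs] := code_nth_surj n (fun j => if insub j is Some i then c' i else existT _ 0%N Bot).
have [d dE] := decode_surj (existT _ n.+1 p, s).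
have [b bE] := decode_surj (existT _ 0%N (Neg Bot), d).
exists (W n p v); split; last exact: (svalP (cid (wit n p v))).
exists (k.+1, b) => //=; rewrite /step bE /= dE /=; congr W.
by apply: funext => i; rewrite hs// valK hc.
Qed.

End Skolem.

(** * Honest definitions *)

Section Honest.
Context (L : language) (P : Type) (ar : P -> nat).
Let L' := add_rel L ar.
Context (X : structure L') (T : theory L) (K : Type).
Hypothesis T_NIP : NIP T.
Hypothesis X_T : models (reduct X) T.
Hypothesis X_sat : saturated K X.
Hypothesis K_big : small K [set: {n : nat & formula L' n}].

(** The finite traces of [Q] are traces of instances of one L-formula.  This is
    what remains, inside [X], of being definable with parameters from an
    elementary extension, and NIP of the formula bounds alternation of [Q]. *)
Definition locally_definable (I : Type) (Q : (I -> X) -> Prop) : Prop :=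
  exists (J : finType) (S : class L (I + J)), udefinable S /\
    forall k (a : 'I_k -> I -> X), exists d : J -> X,
    forall j, Q (a j) <-> S (reduct X) (sumv (a j) d).

(** The formula [S] defines [Q] honestly: the instances approximating [Q] on
    finite sets stay inside [Q]. *)
Definition honestly_definable (I : Type) (Q : (I -> X) -> Prop) : Prop :=
  exists (J : finType) (S : class L (I + J)), udefinable S /\
    forall k (a : 'I_k -> I -> X), (forall j, Q (a j)) ->
    exists e : J -> X, (forall j, S (reduct X) (sumv (a j) e)) /\
      forall x, S (reduct X) (sumv x e) -> Q x.

Section Alternation.
Context (n : nat).
Implicit Types (U : set_system ('I_n -> X)) (a x : 'I_n -> X) (B : set X).

(** An ultrafilter on tuples is read as a global type of the reduct; this says
    that [a] realizes its restriction to [B]. *)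
Definition realizes U B a : Prop :=
  forall J (S : class L ('I_n + J)) (w : J -> X), udefinable S -> (forall j, B (w j)) ->
    S (reduct X) (sumv a w) <-> U [set x | S (reduct X) (sumv x w)].

Lemma realizes_sub U B B' a : B `<=` B' -> realizes U B' a -> realizes U B a.
Proof. by move=> BB h J S w dS Bw; apply: h => // j; exact: BB. Qed.

Definition adjoin B (w : nat -> 'I_n -> X) l : set X :=
  B `|` [set y | exists i t, (i < l)%N /\ y = w i t].

Definition below B l (u : nat * 'I_n + X) : Prop :=
  match u with inl u => (u.1 < l)%N | inr y => B y end.

(** Equality of the L-types over [B] of the first [l] tuples; the variables of
    the formula are assigned freely, through [r], to coordinates and elements of
    [B]. *)
Definition same_type B l (w w' : nat -> 'I_n -> X) : Prop :=
  forall N (p : formula L N) (r : 'I_N -> nat * 'I_n + X),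
    (forall t, below B l (r t)) ->
    @holds L (reduct X) _ p (sumv (fun u => w u.1 u.2) id \o r) <->
    @holds L (reduct X) _ p (sumv (fun u => w' u.1 u.2) id \o r).

(** Whether a formula belongs to the type of the ultrafilter is decided on the
    tuples in [A], whose coordinates lie in [B]; for these the induction
    hypothesis compares the earlier tuples of [w] and [w'].  This is the
    invariance over [B] of a type finitely satisfiable in [B]. *)
Lemma same_typeS U B (A : set ('I_n -> X)) l w w' : UltraFilter U -> B !=set0 ->
  U A -> (forall x i, A x -> B (x i)) -> same_type B l w w' ->
  realizes U (adjoin B w l) (w l) -> realizes U (adjoin B w' l) (w' l) ->
  same_type B l.+1 w w'.
Proof.
move=> UU [y0 By0] UA AB.
suff H v v' : same_type B l v v' ->
    realizes U (adjoin B v l) (v l) -> realizes U (adjoin B v' l) (v' l) ->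
    forall N (p : formula L N) (r : 'I_N -> nat * 'I_n + X),
    (forall t, below B l.+1 (r t)) ->
    @holds L (reduct X) _ p (sumv (fun u => v u.1 u.2) id \o r) ->
    @holds L (reduct X) _ p (sumv (fun u => v' u.1 u.2) id \o r).
  move=> ww' rw rw' N p r ok; split; apply: H => //.
  by move=> N' p' r' ok'; split => /ww'; exact.
move=> vv' rv rv' N p r ok.
pose r1 (t : 'I_N) : 'I_n + 'I_N := match r t with
  | inl u => if u.1 == l then inl u.2 else inr t | inr y => inr t end.
pose par (v : nat -> 'I_n -> X) (t : 'I_N) := match r t with
  | inl u => if u.1 == l then y0 else v u.1 u.2 | inr y => y end.
have E v1 : sumv (fun u => v1 u.1 u.2) id \o r = sumv (v1 l) (par v1) \o r1.
  apply: funext => t; rewrite /r1 /par /=.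
  case rt: (r t) => [[i s]|y] /=; last by rewrite rt.
  by case: eqP => [->//|ne] /=; rewrite rt; case: eqP.
have Bpar v1 t : adjoin B v1 l (par v1 t).
  rewrite /par; have := ok t; case: (r t) => [[i s]|y] /=; last by left.
  case: eqP => [_ _|ne il]; first by left.
  by right; exists i, s; split => //; lia.
pose S (Y : structure L) (u : 'I_n + 'I_N -> Y) := holds p (u \o r1).
have dS : udefinable S by exact: udefinable_holds.
rewrite !E => /(rv _ S _ dS (Bpar v)) Uv; apply/(rv' _ S _ dS (Bpar v')).
apply: filterS (filterI UA Uv) => x [Ax]; rewrite /S /=.
pose r2 t : nat * 'I_n + X := match r t with
  | inl u => if u.1 == l then inr (x u.2) else r t | inr y => r t end.
have E2 v1 : sumv x (par v1) \o r1 = sumv (fun u => v1 u.1 u.2) id \o r2.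
  apply: funext => t; rewrite /r1 /par /r2 /=.
  case rt: (r t) => [[i s]|y] /=; last by rewrite rt.
  by case: eqP => [_|ne] // /=; rewrite rt; case: eqP.
rewrite !E2; apply: (proj1 (vv' _ p r2 _)) => t; rewrite /r2; have := ok t.
case: (r t) => [[i s]|y] //=; case: eqP => [_ _|ne il]; first exact: AB.
by rewrite /=; lia.
Qed.

(** A sequence of successive realizations is indiscernible over [B]. *)
Lemma same_type_sub U B (A : set ('I_n -> X)) (a : nat -> 'I_n -> X) k m f g :
  UltraFilter U -> B !=set0 ->
  U A -> (forall x i, A x -> B (x i)) ->
  (forall i, (i < m)%N -> realizes U (adjoin B a i) (a i)) ->
  {homo f : i j / (i < j)%N} -> {homo g : i j / (i < j)%N} ->
  (forall j, (j < k)%N -> (f j < m)%N) -> (forall j, (j < k)%N -> (g j < m)%N) ->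
  same_type B k (a \o f) (a \o g).
Proof.
move=> UU B0 UA AB ra fi gi fk gk.
suff H l : (l <= k)%N -> same_type B l (a \o f) (a \o g) by exact: H.
elim: l => [_ N p r ok|l IH lk].
  have -> // : sumv (fun u => (a \o f) u.1 u.2) id \o r =
    sumv (fun u => (a \o g) u.1 u.2) id \o r.
  by apply: funext => t /=; have := ok t; case: (r t).
apply: (same_typeS UU B0 UA AB); first by apply: IH; exact: ltnW.
- apply: realizes_sub (ra _ (fk _ lk)) => y [|[i [t [il ->]]]]; first by left.
  by right; exists (f i), t; split => //; exact: fi.
- apply: realizes_sub (ra _ (gk _ lk)) => y [|[i [t [il ->]]]]; first by left.
  by right; exists (g i), t; split => //; exact: gi.
Qed.

Lemma locally_definable_formula Q : @locally_definable 'I_n Q ->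
  exists m (p : formula L (n + m)), forall k (a : 'I_k -> 'I_n -> X),
    exists b : 'I_m -> X, forall j, Q (a j) <-> @holds L (reduct X) _ p (tcat (a j) b).
Proof.
move=> [J [S [/udefinable_split [m [p [d H]]] hS]]]; have [y0] := carrier_inhabited X.
exists m, p => k a; have [b hb] := hS k a; exists (optv y0 b \o d) => j.
by rewrite hb (H (reduct X) b y0).
Qed.

(** In a sequence alternating between [Q] and its complement, any pattern of
    length [k] occurs along an increasing subsequence of length [k].  There it is
    cut out by an instance of [p], since [Q] is locally definable; by
    indiscernibility the same holds for the initial segment of length [k], which
    is thus shattered by [p]. *)
Lemma no_alternation U B (A Q : set ('I_n -> X)) :
  UltraFilter U -> B !=set0 -> U A -> (forall x i, A x -> B (x i)) -> locally_definable Q ->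
  exists m, forall a : nat -> 'I_n -> X,
    (forall i, (i < m)%N -> realizes U (adjoin B a i) (a i)) ->
    ~ forall i, (i < m)%N -> (Q (a i) <-> odd i).
Proof.
move=> UU B0 UA AB /locally_definable_formula [m [p hp]].
have [k hk] := T_NIP p; exists k.*2 => a ra altQ.
apply: (hk _ X_T); exists (fun (j : 'I_k) => a j) => s.
(* the subsequence taking the odd term of the [j]-th pair exactly when [j] is in [s] *)
pose f (j : nat) : nat := (j.*2 + (if insub j is Some j' then j' \in s : nat else 0))%N.
have fP (j : 'I_k) : f j = (j.*2 + (j \in s))%N by rewrite /f valK.
have fb j : (j.*2 <= f j <= j.*2.+1)%N.
  by rewrite /f; case: insub => [j'|]; [case: (j' \in s)|]; lia.
have fi : {homo f : i j / (i < j)%N}.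
  by move=> i j ij; have := fb i; have := fb j; lia.
have fk j : (j < k)%N -> (f j < k.*2)%N by have := fb j; lia.
pose r (j : 'I_k) (u : 'I_(n + m)) : 'I_k * 'I_n + 'I_m :=
  match fintype.split u with inl i => inl (j, i) | inr i => inr i end.
pose S (Y : structure L) (v : 'I_k * 'I_n -> Y) := exists b : 'I_m -> Y,
  forall j, (if j \in s then holds p (sumv v b \o r j)
             else ~ holds p (sumv v b \o r j)).
have [N [q [g H]]] : udefinable S.
  pose S1 (j : 'I_k) (Y : structure L) (v : 'I_k * 'I_n + 'I_m -> Y) :=
    if j \in s then holds p (v \o r j) else ~ holds p (v \o r j).
  apply: (@udefinable_exists _ _ _ (fun Y v => forall j, S1 j Y v)).
  apply: udefinable_conj => j; rewrite /S1.
  by case: (j \in s); [|apply: udefinable_neg]; exact: udefinable_holds.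
have E (w : nat -> 'I_n -> X) b (j : 'I_k) :
    sumv (fun u : 'I_k * 'I_n => w u.1 u.2) b \o r j = tcat (w j) b.
  by apply: funext => u; rewrite /r /tcat /=; case: fintype.split.
have SP (w : nat -> 'I_n -> X) :
    S (reduct X) (fun u => w u.1 u.2) <-> exists b : 'I_m -> X,
    forall j, @holds L (reduct X) _ p (tcat (w (val j)) b) <-> j \in s.
  split=> -[b hb]; exists b => j; have := hb j; rewrite E; case: (j \in s) => //.
  - by move=> [_]; exact.
  - by move=> [h _] /h.
apply/SP; pose g' (t : 'I_N) : nat * 'I_n + X := inl (val (g t).1, (g t).2).
have gP (w : nat -> 'I_n -> X) : (fun u : 'I_k * 'I_n => w u.1 u.2) \o g =
  sumv (fun u => w u.1 u.2) id \o g' by [].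
apply/H; rewrite gP.
have fg : same_type B k (a \o f) (a \o id).
  apply: (same_type_sub UU B0 UA AB ra) => // j jk; lia.
apply: (proj1 (fg _ q g' _)); first by move=> t /=; exact: ltn_ord.
rewrite -gP; apply/H/SP.
have [b hb] := hp k (fun j => a (f j)); exists b => j.
rewrite /= -hb altQ ?fk//; rewrite fP oddD odd_double /=.
by case: (j \in s).
Qed.

End Alternation.

Lemma small_sat (B : set X) : coded L' B -> realizes_types_over B.
Proof. by move=> cB; apply: X_sat; exact: small_coded cB. Qed.

(** Suppose no formula defines [Q] honestly, and choose for each one a finite
    subset of [Q] witnessing the failure.  No L-definable subset of [Q] covers
    the union [AA] of these finite sets, so an ultrafilter [U] contains [AA] and
    avoids every L-definable subset of [Q].  Each restriction of [U] to a small
    set is then realized both in [Q], because [AA] is contained in [Q], and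
    outside [Q].  Realizing it alternately contradicts [no_alternation]. *)
Lemma honest_definition n (q : formula L' n) :
  locally_definable (holds q : ('I_n -> X) -> Prop) ->
  honestly_definable (holds q : ('I_n -> X) -> Prop).
Proof.
set Q := (holds q : ('I_n -> X) -> Prop) => dQ; apply: contrapT => nhQ.
pose covers m (p : formula L' (n + m)) k (a : 'I_k -> 'I_n -> X) :=
  exists e : 'I_m -> X, (forall j, holds p (tcat (a j) e)) /\
    forall x, holds p (tcat x e) -> Q x.
(* the index set consists of L'-formulas, as these measure smallness; only those
   coming from L are used *)
have bad (c : {m & formula L' (n + m)}) : exists u : {k & 'I_k -> 'I_n -> X},
    (forall j, Q (projT2 u j)) /\
    ((exists p, lift_formula ar p = projT2 c) -> ~ covers _ (projT2 c) _ (projT2 u)).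
  case: c => m p' /=.
  have [[p <-]|np] := EM (exists p, lift_formula ar p = p'); last first.
    by exists (existT _ 0%N (@ord0_elim _)); split=> [[]|/np].
  apply: contrapT => h; apply: nhQ.
  exists 'I_m, (fun (Y : structure L) v => holds p (v \o @fintype.split n m)).
  split; first exact: (udefinable_tcat p).
  move=> k a Qa; apply: contrapT => nc; apply: h; exists (existT _ k a); split=> //= _.
  move=> [e [e1 e2]]; apply: nc; exists e; split=> [j|x px].
    by have := e1 j; rewrite holds_lift tcatE.
  by apply: e2; rewrite holds_lift tcatE.
have [A hA] := choice bad.
pose AA : set ('I_n -> X) := [set x | exists c j, x = projT2 (A c) j].
have AAQ : AA `<=` Q by move=> _ [c [j ->]]; exact: (proj1 (hA c)).
have [x0] := carrier_inhabited X.
pose B : set X := [set y | y = x0 \/ exists2 x, AA x & exists i, y = x i].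
have cB : coded L' B.
  pose h (u : {m & formula L' (n + m)} * nat * nat) : X :=
    if insub u.1.2 is Some j then
      if insub u.2 is Some i then projT2 (A u.1.1) j i else x0 else x0.
  have := codedU (coded_range h (covered_prod (covered_prod (covered_shift L' n)
    (covered_nat _)) (covered_nat _))) (coded_seq L' x0 (fun i : 'I_1 => x0)).
  apply: coded_sub => y [->|[x [c [j ->]] [i ->]]]; [right|left].
    by exists ord0.
  by exists (c, val j, val i) => //; rewrite /h /= !valK.
have noD (D : set ('I_n -> reduct X)) : definable D -> AA `<=` D -> D `<=` Q -> False.
  move=> [[m p e] DE] AD DQ.
  pose c : {m & formula L' (n + m)} := existT _ m (lift_formula ar p).
  apply: (proj2 (hA c)); first by exists p.
  have {}DE x : D x <-> holds (lift_formula ar p) (tcat x e).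
    by rewrite DE holds_lift.
  exists e; split=> [j|x /DE /DQ//]; apply/DE/AD; by exists c, j.
pose F : set_system ('I_n -> X) := [set V | exists D : set ('I_n -> reduct X),
  [/\ definable D, D `<=` Q & AA `\` D `<=` V]].
have FF : ProperFilter F.
  split.
    move=> [D [dD DQ AD]]; apply: (noD D dD) => // x Ax.
    by apply: contrapT => nDx; exact: (AD x).
  split.
  - by exists set0; split=> //; exact: definable0.
  - move=> V1 V2 [D1 [d1 Q1 A1]] [D2 [d2 Q2 A2]]; exists (D1 `|` D2); split.
    + exact: definableU.
    + by move=> x [/Q1|/Q2].
    + move=> x [Ax nD]; split; [apply: A1|apply: A2]; split=> // Dx; apply: nD.
        by left.
      by right.
  - by move=> V1 V2 V12 [D [dD DQ AD]]; exists D; split=> // x /AD /V12.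
have [U [UU FU]] := ultraFilterLemma FF.
have UF : Filter U by typeclasses eauto.
have UA : U AA by apply: FU; exists set0; split=> [||x []//]; [exact: definable0|].
have UnQ (D : set ('I_n -> reduct X)) : definable D -> U D -> exists2 x, D x & ~ Q x.
  move=> dD UD; apply: contrapT => nx.
  have UAD : U (AA `\` D).
    by apply: FU; exists D; split=> // x Dx; apply: contrapT => nQ; apply: nx; exists x.
  by have /filter_ex [x [Dx [_]]] := @filterI _ U UF _ _ UD UAD; exact.
(* realizations of [U] over small sets, on the chosen side of [Q] *)
have step (C : set X) (c : bool) : coded L' C -> C !=set0 ->
    exists a, (Q a <-> c) /\ realizes U C a.
  move=> cC C0.
  pose F' : set_system ('I_n -> X) := [set V | exists D : set ('I_n -> reduct X),
    [/\ definable D, U D & D `&` [set x | Q x <-> c] `<=` V]].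
  have FF' : ProperFilter F'.
    split.
      move=> [D [dD UD DV]]; have [ct|/negP cf] := boolP c.
        by have /filter_ex [x [Dx /AAQ Qx]] := @filterI _ U UF _ _ UD UA; apply: (DV x).
      by have [x Dx nQx] := UnQ D dD UD; apply: (DV x); split => //; split.
    split.
    - by exists setT; split=> //; [exact: definableT|exact: filterT].
    - move=> V1 V2 [D1 [d1 U1 A1]] [D2 [d2 U2 A2]]; exists (D1 `&` D2); split.
      + exact: definableI.
      + exact: filterI.
      + by move=> x [[D1x D2x] Qx]; split; [apply: A1|apply: A2].
    - by move=> V1 V2 V12 [D [dD UD DV]]; exists D; split=> // x /DV /V12.
  have [V [VV FV]] := ultraFilterLemma FF'.
  have VF : Filter V by typeclasses eauto.
  have [a ha] := ultra_realized_udefinable (small_sat cC) VV C0.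
  have VQ : V [set x | Q x <-> c].
    by apply: FV; exists setT; split=> [||x []//]; [exact: definableT|exact: filterT].
  exists a; split.
    have VP : (V [set x | Q x]) <-> c.
      split=> [VQ'|ct].
        by have /filter_ex [x [Qx [h _]]] := @filterI _ V VF _ _ VQ' VQ; exact: h.
      by apply: filterS VQ => x Qx; exact/Qx.
    rewrite -VP; have := ha _ _ (@ord0_elim X) (@udefinable_holds L' ('I_n + 'I_0) n q inl).
    by move=> /(_ _); apply; case.
  move=> J S w dS Cw.
  have dD : definable ([set x | S (reduct X) (sumv x w)] : set ('I_n -> reduct X)).
    exact: definable_udefinable.
  rewrite (ha _ _ w (udefinable_lift ar dS) Cw).
  split=> [Vx|Ux]; last first.
    by apply: FV; exists [set x | S (reduct X) (sumv x w)]; split=> // x [].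
  case: (in_ultra_setVsetC [set x | S (reduct X) (sumv x w)] UU) => // Un.
  have /FV Vn : F' (~` [set x | S (reduct X) (sumv x w)]).
    by exists (~` [set x | S (reduct X) (sumv x w)]); split=> [||x []//] //; exact: definableC.
  by have /filter_ex [x []] := @filterI _ V VF _ _ Vx Vn.
have B0 : B !=set0 by exists x0; left.
have AB x i : AA x -> B (x i) by move=> Ax; right; exists x => //; exists i.
have [m hm] := no_alternation UU B0 UA AB dQ.
suff [a [ra Qa]] : exists a : nat -> 'I_n -> X,
    (forall i, (i < m)%N -> realizes U (adjoin B a i) (a i)) /\
    forall i, (i < m)%N -> (Q (a i) <-> odd i) by exact: hm ra Qa.
elim: m {hm} => [|m [a [ra Qa]]]; first by exists (fun _ _ => x0).
have cBa : coded L' (adjoin B a m).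
  pose h (u : nat * nat) : X := if insub u.2 is Some t then a u.1 t else x0.
  apply: codedU => //.
  apply: coded_sub (coded_range h (covered_prod (covered_nat _) (covered_nat _))).
  by move=> y [i [t [_ ->]]]; exists (i, val t) => //; rewrite /h /= valK.
have [|a' [Qa' ra']] := step (adjoin B a m) (odd m) cBa.
  by exists x0; left; left.
pose b i := if i == m then a' else a i.
have bE i : (i <= m)%N -> adjoin B b i = adjoin B a i.
  move=> im; rewrite /adjoin; congr (_ `|` _); apply/seteqP.
  by split=> y [j [t [ji ->]]]; exists j, t; split=> //; rewrite /b;
    case: eqP => // jm; lia.
exists b; split=> i; rewrite ltnS => im; rewrite ?bE// /b; case: eqP => [->//|] ne.
  by apply: ra; lia.
by apply: Qa; lia.
Qed.

Fixpoint unlift_term n (t : term L' n) : term L n := match t with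
  | Var i => Var i
  | App f ts => @App L n f (fun i => unlift_term (ts i)) end.

Lemma teval_unlift n (t : term L' n) (v : 'I_n -> X) :
  teval t v = @teval L (reduct X) n (unlift_term t) v.
Proof.
by elim: t => //= f ts IH; congr (@finterp L' X f _); apply: funext => i; exact: IH.
Qed.

Lemma locally_definable_plain n (Q : ('I_n -> X) -> Prop) (p : formula L n) :
  (forall v, Q v <-> @holds L (reduct X) n p v) -> locally_definable Q.
Proof.
move=> Qp; exists 'I_0, (fun Y v => holds p (v \o inl)); split; first exact: udefinable_holds.
by move=> k a; exists (@ord0_elim X) => j; exact: Qp.
Qed.

Lemma locally_definable_neg (I : Type) (Q : (I -> X) -> Prop) :
  locally_definable Q -> locally_definable (fun v => ~ Q v).
Proof.
move=> [J [S [dS hS]]]; exists J, (fun Y v => ~ S Y v); split; first exact: udefinable_neg.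
by move=> k a; have [d hd] := hS k a; exists d => j; rewrite hd.
Qed.

Lemma locally_definable_imp (I : Type) (Q1 Q2 : (I -> X) -> Prop) :
  locally_definable Q1 -> locally_definable Q2 -> locally_definable (fun v => Q1 v -> Q2 v).
Proof.
move=> [J1 [S1 [dS1 h1]]] [J2 [S2 [dS2 h2]]].
pose g1 (u : I + J1) : I + (J1 + J2) := match u with inl i => inl i | inr j => inr (inl j) end.
pose g2 (u : I + J2) : I + (J1 + J2) := match u with inl i => inl i | inr j => inr (inr j) end.
exists (J1 + J2)%type, (fun Y v => S1 Y (v \o g1) -> S2 Y (v \o g2)); split.
  by apply: udefinable_imp; exact: udefinable_ren.
move=> k a; have [d1 hd1] := h1 k a; have [d2 hd2] := h2 k a.
exists (sumv d1 d2) => j; rewrite hd1 hd2.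
have -> : sumv (a j) (sumv d1 d2) \o g1 = sumv (a j) d1 by apply: funext => -[].
by have -> : sumv (a j) (sumv d1 d2) \o g2 = sumv (a j) d2 by apply: funext => -[].
Qed.

(** A projection of an honestly definable set is locally definable: for finitely
    many points choose witnesses in the fibres, cover them by an instance of the
    honest definition, and project this instance.  It covers the given points of
    the projection, and nothing outside since it stays inside the set.  Here the
    set is the negation of [q]. *)
Lemma locally_definable_all n (q : formula L' n.+1) :
  locally_definable (holds q : ('I_n.+1 -> X) -> Prop) ->
  locally_definable (holds (All q) : ('I_n -> X) -> Prop).
Proof.
move=> /locally_definable_neg dq; have [J [S [dS hS]]] := @honest_definition _ (Neg q) dq.
pose g (u : 'I_n.+1 + J) : option ('I_n + J) := match u with
  | inl i => omap inl (unlift ord0 i) | inr j => Some (inr j) end.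
have E (Y : Type) (y : Y) v e : optv y (sumv v e) \o g = sumv (tcons y v) e.
  apply: funext => -[i|j] //=; rewrite /tcons.
  by case: unlift.
pose S' (Y : structure L) (v : 'I_n + J -> Y) := forall y, ~ S Y (optv y v \o g).
exists J, S'; split.
  have := udefinable_neg (udefinable_ren g dS).
  exact: (@udefinable_forall1 _ _ (fun Y v => ~ S Y (v \o g))).
move=> k a; rewrite /S'.
suff [e [e1 e2]] : exists e : J -> X, (forall j y, ~ holds q (tcons y (a j)) ->
    exists y, S (reduct X) (sumv (tcons y (a j)) e)) /\
    forall x, S (reduct X) (sumv x e) -> ~ holds q x.
  exists e => j /=; split=> [h y|h y]; first by rewrite E => /e2; apply; exact: h.
  apply: contrapT => /e1 [y' Sy']; apply: (h y').
  by rewrite E.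
have [[x0 nx0]|nx] := EM (exists x : 'I_n.+1 -> X, ~ holds q x); last first.
  have [|e [_ e2]] := hS 0%N (@ord0_elim _); first by case.
  by exists e; split=> // j y nq; case: nx; exists (tcons y (a j)).
have /choice [b hb] : forall j, exists x : 'I_n.+1 -> X, ~ holds q x /\
    ((exists y, ~ holds q (tcons y (a j))) -> exists y, x = tcons y (a j)).
  move=> j; have [[y ny]|nny] := EM (exists y, ~ holds q (tcons y (a j))).
    by exists (tcons y (a j)); split=> // _; exists y.
  by exists x0; split.
have [|e [e1 e2]] := hS k b; first by move=> j; exact: (proj1 (hb j)).
exists e; split=> // j y nq; have [_ [|y' bE]] := hb j; first by exists y.
by exists y'; rewrite -bE.
Qed.

Lemma locally_definable_all_formulas :
  (forall s : P, locally_definable (@rinterp L' X (inr s) : ('I_(ar s) -> X) -> Prop)) ->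
  forall n (q : formula L' n), locally_definable (holds q : ('I_n -> X) -> Prop).
Proof.
move=> hs n q; elim: q => {n} [n t u|n [r|s] ts|n|n p IHp q IHq|n q].
- by apply: (@locally_definable_plain _ _ (Equal (unlift_term t) (unlift_term u))) => v /=;
    rewrite !teval_unlift.
- apply: (@locally_definable_plain _ _ (@Rel L n r (fun i => unlift_term (ts i)))) => v /=.
  suff -> : (fun i => teval (ts i) v) =
    (fun i => @teval L (reduct X) n (unlift_term (ts i)) v) by [].
  by apply: funext => i; rewrite teval_unlift.
- have [m [p hp]] := locally_definable_formula (hs s).
  pose s1 (u : 'I_(ar s + m)) : term L (n + m) := match fintype.split u with
    | inl i => subst_term (fun i' => Var (lshift m i')) (unlift_term (ts i))
    | inr j => Var (rshift n j) end.
  exists 'I_m, (fun Y v => holds (subst p s1) (v \o @fintype.split n m)); split.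
    exact: udefinable_tcat.
  move=> k a; have [b hb] := hp k (fun j i => teval (ts i) (a j)); exists b => j.
  rewrite /= hb -tcatE holds_subst.
  suff -> : (fun i => @teval L (reduct X) _ (s1 i) (tcat (a j) b)) =
    tcat (fun i => teval (ts i) (a j)) b by [].
  apply: funext => u; rewrite /s1 [RHS]/tcat; case: fintype.split => [i|i].
    rewrite teval_subst teval_unlift; congr teval.
    by apply: funext => i' /=; rewrite tcat_l.
  by rewrite /= tcat_r.
- exact: (@locally_definable_plain _ _ Bot).
- exact: locally_definable_imp.
- exact: locally_definable_all.
Qed.

End Honest.

(** * Extending measures from L to the expansion *)

Section Extension.
Context (R : realType) (L : language) (P : Type) (ar : P -> nat).
Let L' := add_rel L ar.
Context (X : structure L').
Hypothesis honestX : forall n (q : formula L' n),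
  honestly_definable (holds q : ('I_n -> X) -> Prop).
Context (n : nat).
Implicit Types (mu : keisler R (reduct X) n) (nu : keisler R X n).

(** The part of the variables filled by [b] is turned into parameters.  Points
    outside the instance of [q] need not be covered, so they may be replaced by
    any point of the instance. *)
Lemma honest_family m (q : formula L' (n + m)) :
  exists (J : finType) (S : class L ('I_n + ('I_m + J))), udefinable S /\
  forall k (a : 'I_k -> 'I_n -> X) (b : 'I_m -> X), exists e : J -> X,
    (forall j, holds q (tcat (a j) b) -> S (reduct X) (sumv (a j) (sumv b e))) /\
    forall x, S (reduct X) (sumv x (sumv b e)) -> holds q (tcat x b).
Proof.
have [J [S [dS hS]]] := honestX q.
pose g (u : 'I_(n + m) + J) : 'I_n + ('I_m + J) := match u with
  | inl i => match fintype.split i with inl i => inl i | inr i => inr (inl i) end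
  | inr j => inr (inr j) end.
have E (x : 'I_n -> X) (b : 'I_m -> X) (e : J -> X) :
    sumv x (sumv b e) \o g = sumv (tcat x b) e.
  by apply: funext => -[i|j] //=; rewrite /tcat; case: fintype.split.
exists J, (fun Y v => S Y (v \o g)); split; first exact: udefinable_ren.
move=> k a b; have [[x0 qx0]|nq] := EM (exists x : 'I_n -> X, holds q (tcat x b)); last first.
  have [|e [_ he]] := hS 0%N (@ord0_elim _); first by case.
  exists e; split=> [j qj|x]; first by case: nq; exists (a j).
  by rewrite E => /he.
pose a' j := if `[< holds q (tcat (a j) b) >] then a j else x0.
have [|e [e1 e2]] := hS k (fun j => tcat (a' j) b).
  by move=> j; rewrite /a'; case: asboolP.
exists e; split=> [j qj|x]; last by rewrite E => /e2.
by have := e1 j; rewrite E /a' asboolT.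
Qed.

(** The lower approximation is the honest instance [S], the upper one the
    complement of an honest instance [S'] for the negation.  Both are chosen to
    cover, on their sides, a net for the complement of [S] or [S']; being missed
    by the net, this complement is small.  [S] depends neither on [b] nor on
    [e]. *)
Lemma inner_approx mu A m (q : formula L' (n + m)) : has_nets mu A ->
  exists (J : finType) (S : class L ('I_n + ('I_m + J))), udefinable S /\
  forall e : R, 0 < e -> forall b : 'I_m -> X,
  exists (w : J -> X) (D : set ('I_n -> reduct X)),
    [/\ definable D,
      forall x, S (reduct X) (sumv x (sumv b w)) -> holds q (tcat x b),
      forall x, holds q (tcat x b) -> D x &
      mass mu D <= mass mu [set x | S (reduct X) (sumv x (sumv b w))] + e].
Proof.
move=> netA; have [J [S [dS hS]]] := honest_family q.
have [J' [S' [dS' hS']]] := honest_family (Neg q).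
exists J, S; split=> // e e0 b.
pose g1 (u : 'I_n + ('I_m + J)) : 'I_n + ('I_m + (J + J')) := match u with
  | inl i => inl i | inr (inl i) => inr (inl i) | inr (inr j) => inr (inr (inl j)) end.
pose g2 (u : 'I_n + ('I_m + J')) : 'I_n + ('I_m + (J + J')) := match u with
  | inl i => inl i | inr (inl i) => inr (inl i) | inr (inr j) => inr (inr (inr j)) end.
pose V (Y : structure L) (v : 'I_n + ('I_m + (J + J')) -> Y) :=
  ~ (S Y (v \o g1) \/ S' Y (v \o g2)).
have dV : udefinable V by apply/udefinable_neg/udefinable_or; exact: udefinable_ren.
have [k [a [_ ha]]] := netA _ _ dV _ e0.
have [w [w1 w2]] := hS k a b; have [w' [w'1 w'2]] := hS' k a b.
have E1 (x : 'I_n -> X) : sumv x (sumv b (sumv w w')) \o g1 = sumv x (sumv b w).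
  by apply: funext => -[|[]].
have E2 (x : 'I_n -> X) : sumv x (sumv b (sumv w w')) \o g2 = sumv x (sumv b w').
  by apply: funext => -[|[]].
pose D1 : set ('I_n -> reduct X) := [set x | S (reduct X) (sumv x (sumv b w))].
pose D2 : set ('I_n -> reduct X) := [set x | S' (reduct X) (sumv x (sumv b w'))].
have dD1 : definable D1 by exact: definable_udefinable.
have dD2 : definable D2 by exact: definable_udefinable.
have dVb : definable ([set x | V (reduct X) (sumv x (sumv b (sumv w w')))] :
  set ('I_n -> reduct X)) by exact: definable_udefinable.
exists w, (~` D2); split=> //; first exact: definableC.
- by move=> x qx /w'2; exact.
- apply: (@le_trans _ _ (mass mu (D1 `|` [set x | V (reduct X) (sumv x (sumv b (sumv w w')))]))).
    apply: le_mass; [exact: definableC|exact: definableU|] => x nD2.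
    have [|nD1] := EM (D1 x); [by left|right].
    by rewrite /= /V E1 E2 => -[].
  apply: le_trans (mass_leU _ _ _) _ => //; rewrite lerD2l leNgt; apply/negP => /ltW /ha [j].
  rewrite /V E1 E2; apply; have [qj|nqj] := EM (holds q (tcat (a j) b)).
    by left; exact: w1.
  by right; exact: w'1.
Qed.

Lemma mass_restrict nu (D : set ('I_n -> reduct X)) : definable D ->
  mass (restrict_keisler nu) D = mass nu D.
Proof.
move=> dD; rewrite -[D]/(dset (DefinableSet dD)) mass_dset /= /restrict_fun.
by rewrite -mass_dset.
Qed.

Lemma definable_reduct (D : set ('I_n -> reduct X)) : definable D ->
  definable (D : set ('I_n -> X)).
Proof. by move=> dD; exact: (definable_lift (DefinableSet dD)). Qed.

Lemma sandwich mu A (D : set ('I_n -> X)) (e : R) : has_nets mu A -> definable D -> 0 < e ->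
  exists D1 D2 : set ('I_n -> reduct X),
    [/\ definable D1, definable D2, D1 `<=` D, D `<=` D2 & mass mu D2 <= mass mu D1 + e].
Proof.
move=> netA [[m q b] ->] e0; have [J [S [dS hS]]] := inner_approx q netA.
have [w [D2 [dD2 h1 h2 h3]]] := hS e e0 b.
exists [set x | S (reduct X) (sumv x (sumv b w))], D2; split=> //.
exact: definable_udefinable.
Qed.

Lemma extension_unique A nu nu' : has_nets (restrict_keisler nu) A ->
  restrict_keisler nu' = restrict_keisler nu -> nu' = nu.
Proof.
move=> netA nunu'; apply: keisler_ext => D dD.
suff H (e : R) : 0 < e -> `|mass nu' D - mass nu D| <= e.
  apply/eqP; rewrite -subr_eq0 -normr_le0; apply/ler_addgt0Pr => e e0.
  by rewrite add0r H.
move=> e0; have [D1 [D2 [d1 d2 D1D DD2]]] := sandwich netA dD e0.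
have dd1 := definable_reduct d1; have dd2 := definable_reduct d2.
rewrite ler_norml.
have := le_mass nu dd1 dD D1D; have := le_mass nu dD dd2 DD2.
have := le_mass nu' dd1 dD D1D; have := le_mass nu' dD dd2 DD2.
rewrite -!(mass_restrict _ d1) -!(mass_restrict _ d2) nunu' => *; lra.
Qed.

(** A large instance of [q] contains an honest instance of [S] of almost the same
    measure, so a net for [S] is a net for [q]. *)
Lemma nets_extension A nu : has_nets (restrict_keisler nu) A -> has_nets nu A.
Proof.
move=> netA I Q /udefinable_split [m [q [d H]]] e e0; have [y0] := carrier_inhabited X.
have [J [S [dS hS]]] := inner_approx q netA.
have e20 : 0 < e / 2 by rewrite divr_gt0.
have [k [a [Aa ha]]] := netA _ _ dS _ e20.
exists k, a; split=> // w; set b := optv y0 w \o d.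
rewrite (_ : [set x | _] = [set x | holds q (tcat x b)]); last first.
  by apply/seteqP; split=> x /=; rewrite (H X w y0).
have dq : definable [set x : 'I_n -> X | holds q (tcat x b)] by exists (PFormula q b).
have [v [D [dD h1 h2 h3]]] := hS _ e20 b.
move=> le; have [|j /h1] := ha (sumv b v); last by rewrite -(H X w y0); exists j.
have := le_mass nu dq (definable_reduct dD) h2; rewrite -(mass_restrict nu dD).
by move=> h; rewrite -(lerD2r (e / 2)) -splitr; exact: le_trans (le_trans le h) h3.
Qed.

Section Inner.
Context (mu : keisler R (reduct X) n) (A : set X).
Hypothesis netA : has_nets mu A.

Definition inner (D : set ('I_n -> X)) : R :=
  sup [set r | exists E : set ('I_n -> reduct X), [/\ definable E, E `<=` D & r = mass mu E]].

Lemma has_sup_inner D : has_sup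
  [set r | exists E : set ('I_n -> reduct X), [/\ definable E, E `<=` D & r = mass mu E]].
Proof.
split; first by exists (mass mu set0), set0; split=> //; exact: definable0.
by exists 1 => _ [E [_ _ ->]]; exact: mass_le1.
Qed.

Lemma inner_ge (D E : set ('I_n -> reduct X)) : definable E -> E `<=` D -> mass mu E <= inner D.
Proof.
by move=> dE ED; apply: ub_le_sup; [exact: (proj2 (has_sup_inner D))|exists E].
Qed.

Lemma inner_le (D : set ('I_n -> X)) r :
  (forall E : set ('I_n -> reduct X), definable E -> E `<=` D -> mass mu E <= r) ->
  inner D <= r.
Proof.
by move=> h; apply: ge_sup; [exact: (proj1 (has_sup_inner D))|move=> _ [E [dE ED ->]]; exact: h].
Qed.

Lemma inner_definable (D : set ('I_n -> reduct X)) : definable D -> inner D = mass mu D.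
Proof.
move=> dD; apply/eqP; rewrite eq_le inner_ge// andbT; apply: inner_le => E dE ED.
exact: le_mass.
Qed.

Lemma inner_outer (D : set ('I_n -> X)) (e : R) : definable D -> 0 < e ->
  exists E : set ('I_n -> reduct X), [/\ definable E, D `<=` E & mass mu E <= inner D + e].
Proof.
move=> dD e0; have [D1 [D2 [d1 d2 D1D DD2 h]]] := sandwich netA dD e0.
by exists D2; split=> //; apply: le_trans h _; rewrite lerD2r inner_ge.
Qed.

(** Inner measures are superadditive; subadditivity holds because the inner
    measure is also an outer one, by [sandwich]. *)
Lemma innerU (D1 D2 : set ('I_n -> X)) : definable D1 -> definable D2 ->
  D1 `&` D2 = set0 -> inner (D1 `|` D2) = inner D1 + inner D2.
Proof.
move=> d1 d2 D12; apply/eqP; rewrite eq_le; apply/andP; split.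
  apply/ler_addgt0Pr => e e0; have e20 : 0 < e / 2 by rewrite divr_gt0.
  have [E1 [dE1 DE1 h1]] := inner_outer d1 e20.
  have [E2 [dE2 DE2 h2]] := inner_outer d2 e20.
  apply: inner_le => E dE ED.
  have : mass mu E <= mass mu (E1 `|` E2).
    by apply: le_mass => //; [exact: definableU|move=> x /ED [/DE1|/DE2]; [left|right]].
  by have := mass_leU mu dE1 dE2; lra.
rewrite -lerBrDr; apply: inner_le => E1 dE1 ED1.
rewrite lerBrDr addrC -lerBrDr; apply: inner_le => E2 dE2 ED2.
rewrite lerBrDr addrC -massU//.
  by apply: inner_ge; [exact: definableU|move=> x [/ED1|/ED2]; [left|right]].
apply/seteqP; split=> x // [/ED1 x1 /ED2 x2].
by have : (D1 `&` D2) x by []; rewrite D12.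
Qed.

Lemma extension_exists : exists nu, restrict_keisler nu = mu.
Proof.
have h0 (D : definable_set X n) : 0 <= inner D.
  apply: le_trans (mass_ge0 mu set0) _; apply: inner_ge => //; exact: definable0.
have hT (D : definable_set X n) : dset D = setT -> inner D = 1.
  by move=> ->; rewrite (inner_definable (@definableT _ (reduct X) n)) massT.
have hU (D1 D2 D : definable_set X n) : dset D1 `&` dset D2 = set0 ->
    dset D = dset D1 `|` dset D2 -> inner D = inner D1 + inner D2.
  by move=> D12 ->; apply: innerU => //; exact: dset_definable.
exists (Keisler h0 hT hU); apply: keisler_ext => D dD; rewrite mass_restrict//.
have dD' := definable_reduct dD.
by rewrite -[D]/(dset (DefinableSet dD')) mass_dset /= inner_definable.
Qed.

End Inner.
End Extension.

(** * The basic relations of the Shelah expansion *)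

Section Shelah.
Context (L : language) (M N : structure L) (i : M -> N).
Hypothesis i_elem : elementary_embedding i.
Let L' := shelah_language L N.
Let MS : structure L' := shelah_expansion i.
Context (X : structure L').
Hypothesis X_MS : models X (Th MS).

Lemma holds_reduct_MS n (p : formula L n) (v : 'I_n -> M) :
  @holds L (reduct MS) n p v = @holds L M n p v.
Proof. by rewrite /MS /shelah_expansion /shelah_structure; clear; case: M i v. Qed.

Lemma models_reduct (T : theory L) : models M T -> models (reduct X) T.
Proof.
move=> MT s Ts v; have : Th MS (lift_formula _ s).
  by move=> u; rewrite holds_lift holds_reduct_MS; exact: MT.
by move=> /X_MS /(_ v); rewrite holds_lift.
Qed.

Lemma sentence_transfer (S : class L' 'I_0) : udefinable S ->
  (forall v, S MS v) -> forall v, S X v.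
Proof.
move=> [k [p [r H]]] hS v; apply/H; apply/(@holds_rename L' X _ _ r p v).
by apply: (X_MS (s := rename r p)) => u; apply/holds_rename/H.
Qed.

(** For a relation [phi(x,d)] of the expansion, the formula is [phi(x,y)].  At
    finitely many points of [M] the parameter [d] in [N] can be replaced by one in
    [M], by elementarity; for each number of points this is an L'-sentence, which
    passes to [X]. *)
Lemma locally_definable_symbol (s : {n : nat & pformula L N n}) :
  locally_definable (@rinterp L' X (inr s) : ('I_(projT1 s) -> X) -> Prop).
Proof.
pose n := projT1 s; pose m := pf_arity (projT2 s); pose p := pf_formula (projT2 s).
exists 'I_m, (fun Y v => holds p (v \o @fintype.split n m)); split; first exact: udefinable_tcat.
move=> k a.
pose r1 (j : 'I_k) (t : 'I_n) : ('I_0 + 'I_k * 'I_n) + 'I_m := inl (inr (j, t)).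
pose r2 (j : 'I_k) (u : 'I_(n + m)) : ('I_0 + 'I_k * 'I_n) + 'I_m :=
  match fintype.split u with inl t => inl (inr (j, t)) | inr t => inr t end.
pose S1 (j : 'I_k) (Y : structure L') (v : ('I_0 + 'I_k * 'I_n) + 'I_m -> Y) :=
  @rinterp L' Y (inr s) (v \o r1 j) <-> @holds L (reduct Y) _ p (v \o r2 j).
have dS1 j : udefinable (S1 j).
  apply: udefinable_iff; last exact: (udefinable_lift _ (udefinable_holds p (r2 j))).
  exact: (@udefinable_holds L' _ _ (@Rel L' n (inr s) Var) (r1 j)).
pose S2 (Y : structure L') (v : 'I_0 + 'I_k * 'I_n -> Y) :=
  exists b : 'I_m -> Y, forall j, S1 j Y (sumv v b).
have dS2 : udefinable S2.
  exact: (@udefinable_exists _ _ _ (fun Y v => forall j, S1 j Y v) (udefinable_conj dS1)).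
pose S3 (Y : structure L') (v : 'I_0 -> Y) := forall w : 'I_k * 'I_n -> Y, S2 Y (sumv v w).
have dS3 : udefinable S3 by exact: (@udefinable_forall _ _ _ S2 dS2).
have E (Y : Type) (v : 'I_0 -> Y) (w : 'I_k * 'I_n -> Y) b j :
    sumv (sumv v w) b \o r2 j = tcat (fun t => w (j, t)) b.
  by apply: funext => u; rewrite /= /r2 /tcat; case: fintype.split.
have /sentence_transfer -/(_ dS3) : forall v, S3 MS v.
  move=> v w.
  (* the pattern of the given points, found by [d] in [N] and then in [M] *)
  pose c j := `[< pholds id (projT2 s) (i \o (fun t => w (j, t))) >].
  pose S4 (Y : structure L) (u : 'I_k * 'I_n -> Y) := exists b : 'I_m -> Y,
    forall j, (if c j then id else not) (holds p (tcat (fun t => u (j, t)) b)).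
  have dS4 : udefinable S4.
    pose r4 (j : 'I_k) (u : 'I_(n + m)) : 'I_k * 'I_n + 'I_m :=
      match fintype.split u with inl t => inl (j, t) | inr t => inr t end.
    pose S5 (j : 'I_k) (Y : structure L) (u : 'I_k * 'I_n + 'I_m -> Y) :=
      (if c j then id else not) (holds p (u \o r4 j)).
    have := @udefinable_exists _ _ _ (fun Y v => forall j, S5 j Y v).
    move=> H; apply: udefinable_ext (H _); last first.
      apply: udefinable_conj => j; rewrite /S5.
      by case: (c j); [|apply: udefinable_neg]; exact: udefinable_holds.
    move=> Y u; split=> -[b hb]; exists b => j; have := hb j;
      rewrite /S5 (_ : sumv u b \o r4 j = tcat (fun t => u (j, t)) b)//;
      by apply: funext => t; rewrite /= /r4 /tcat; case: fintype.split.
  have : S4 M w.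
    apply/(@elementary_udefinable L M N i _ S4 w i_elem dS4).
    exists (pf_param (projT2 s)) => j; rewrite /c; case: asboolP => //.
  move=> [b hb]; exists b => j; rewrite /S1 E holds_reduct_MS.
  have := hb j; rewrite /c; case: asboolP => [h1 h2|h1 h2].
    by split.
  by split=> // /h1.
move=> /(_ (@ord0_elim X) (fun u => a u.1 u.2)) [b hb]; exists b => j.
by have := hb j; rewrite /S1 E -tcatE.
Qed.

End Shelah.

(** * Shrinking nets *)

(** Each formula needs finitely many points for each error [1/(l+1)]. *)
Lemma nets_coded (R : realType) (L : language) (X : structure L) n
    (mu : keisler R X n) (A : set X) : has_nets mu A ->
  exists A1 : set X, [/\ A1 `<=` A, coded L A1 & has_nets mu A1].
Proof.
move=> netA.
have /choice [a ha] : forall c : {m & formula L (n + m)} * nat,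
    exists a : {k & 'I_k -> 'I_n -> X}, (forall j t, A (projT2 a j t)) /\
    forall b, c.2.+1%:R^-1 <= mass mu [set x | holds (projT2 c.1) (tcat x b)] ->
    exists j, holds (projT2 c.1) (tcat (projT2 a j) b).
  move=> [[m p] l] /=.
  have [|k [a [Aa ha]]] := netA _ _ (udefinable_tcat p) l.+1%:R^-1; first by rewrite invr_gt0.
  by exists (existT _ k a).
pose A1 : set X := [set y | exists c j t, y = projT2 (a c) j t].
have [x0] := carrier_inhabited X.
exists A1; split.
- by move=> _ [c [j [t ->]]]; exact: (proj1 (ha c)).
- pose h (u : {m & formula L (n + m)} * nat * nat * nat) : X :=
    if insub u.1.2 is Some j then
      if insub u.2 is Some t then projT2 (a u.1.1) j t else x0 else x0.
  have cn := covered_nat L.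
  have := coded_range h (covered_prod (covered_prod (covered_prod (covered_shift L n) cn) cn) cn).
  apply: coded_sub => _ [c [j [t ->]]].
  by exists (c, val j, val t) => //; rewrite /h /= !valK.
move=> J S /udefinable_split [m [p [d H]]] e e0.
have [l le] : exists l : nat, l.+1%:R^-1 < e.
  by have [l] := ltr_add_invr e0; rewrite add0r; exists l.
pose c : {m & formula L (n + m)} * nat := (existT _ m p, l).
exists (projT1 (a c)), (projT2 (a c)); split; first by move=> j t; exists c, j, t.
move=> w; rewrite (_ : [set x | _] = [set x | holds p (tcat x (optv x0 w \o d))]); last first.
  by apply/seteqP; split=> x /=; rewrite (H X w x0).
move=> /(le_trans (ltW le)) /(proj2 (ha c)) [j hj]; exists j.
by rewrite (H X w x0).
Qed.

(** * Types over a set *)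

Section Types.
Context (L : language) (X : structure L).
Implicit Types A : set X.

Lemma tp_eqP A m (b b' : 'I_m -> X) :
  (forall psi : pformula L A m, pholds set_val psi b <-> pholds set_val psi b') ->
  tp A b = tp A b'.
Proof.
move=> h; have E : tp_mem A b = tp_mem A b' by apply: funext => psi; exact: propext (h psi).
rewrite /tp; move: (@tp_finsat L X A m b) (@tp_complete L X A m b).
move: (@tp_finsat L X A m b') (@tp_complete L X A m b').
rewrite E => f1 c1 f2 c2.
by rewrite (Prop_irrelevance f1 f2) (Prop_irrelevance c1 c2).
Qed.

Lemma tp_udefinable A m (b b' : 'I_m -> X) J (S : class L ('I_m + J)) (w : J -> X) :
  tp A b = tp A b' -> udefinable S -> (forall j, A (w j)) ->
  S X (sumv b w) <-> S X (sumv b' w).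
Proof.
move=> /(congr1 (@type_mem _ _ _ _)) bb' dS Aw.
have {}bb' (psi : pformula L A m) : pholds set_val psi b <-> pholds set_val psi b'.
  by have := congr1 (fun q => q psi) bb'; rewrite /= /tp_mem /= => ->.
have [[a0 Aa0]|A0] := EM (A !=set0).
  have [k [p [d H]]] := udefinable_split dS.
  pose w' j : A := SigSub (mem_set (Aw j)).
  pose a0' : A := SigSub (mem_set Aa0).
  have E : set_val \o (optv a0' w' \o d) = optv a0 w \o d.
    by apply: funext => t /=; case: (d t).
  rewrite !(H X w a0) -E; exact: (bb' (PFormula p (optv a0' w' \o d))).
(* without elements of [A] there are no parameters at all *)
have noJ (j : J) : False by apply: A0; exists (w j).
case: dS => k [p [r H]].
pose r0 (t : 'I_k) : 'I_(m + 0) := match r t with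
  | inl u => lshift 0 u | inr j => match noJ j with end end.
have E c : sumv c w \o r = tcat c (set_val \o @ord0_elim A) \o r0.
  apply: funext => t; rewrite /r0 /=; case: (r t) => [u|j]; last by case: (noJ j).
  by rewrite tcat_l.
rewrite !H !E -!holds_rename.
exact: (bb' (PFormula (rename r0 p) (@ord0_elim A))).
Qed.

(** The sets of [z] defined by formulas true of [b], [c] over [A], with [b]
    replaced by [b'], are nonempty as [b] and [b'] have the same type; they
    generate a filter, which saturation over [C] realizes. *)
Lemma tp_extend A C m (b b' : 'I_m -> X) k (c : 'I_k -> X) :
  realizes_types_over C -> C !=set0 -> A `<=` C -> (forall t, C (b' t)) ->
  tp A b = tp A b' ->
  exists c' : 'I_k -> X, forall J (S : class L (('I_m + 'I_k) + J)) (w : J -> X),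
    udefinable S -> (forall t, A (w t)) ->
    S X (sumv (sumv b c) w) -> S X (sumv (sumv b' c') w).
Proof.
move=> satC C0 AC Cb' bb'.
pose F : set_system ('I_k -> X) := [set V |
  exists J (S : class L (('I_m + 'I_k) + J)) (w : J -> X),
  [/\ udefinable S, forall t, A (w t), S X (sumv (sumv b c) w) &
      [set z | S X (sumv (sumv b' z) w)] `<=` V]].
have FF : ProperFilter F.
  split.
    move=> [J [S [w [dS Aw Sbc SV]]]].
    pose g (u : ('I_m + 'I_k) + J) : ('I_m + J) + 'I_k := match u with
      | inl (inl u) => inl (inl u) | inl (inr t) => inr t | inr j => inl (inr j) end.
    have E (d : 'I_m -> X) (z : 'I_k -> X) : sumv (sumv d w) z \o g = sumv (sumv d z) w.
      by apply: funext => -[[]|].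
    pose S' (Y : structure L) (v : 'I_m + J -> Y) :=
      exists z : 'I_k -> Y, S Y (sumv v z \o g).
    have dS' : udefinable S'.
      exact: (@udefinable_exists _ _ _ (fun Y v => S Y (v \o g)) (udefinable_ren g dS)).
    have : S' X (sumv b' w) by apply/(tp_udefinable bb' dS' Aw); exists c; rewrite E.
    by move=> [z]; rewrite E => /SV.
  split.
  - exists 'I_0, (fun Y v => ~ False), (@ord0_elim X); split=> //; last by case.
    exact/udefinable_neg/udefinable_bot.
  - move=> V1 V2 [J1 [S1 [w1 [d1 A1 h1 H1]]]] [J2 [S2 [w2 [d2 A2 h2 H2]]]].
    pose g1 (u : ('I_m + 'I_k) + J1) : ('I_m + 'I_k) + (J1 + J2) :=
      match u with inl u => inl u | inr j => inr (inl j) end.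
    pose g2 (u : ('I_m + 'I_k) + J2) : ('I_m + 'I_k) + (J1 + J2) :=
      match u with inl u => inl u | inr j => inr (inr j) end.
    have E1 d : sumv d (sumv w1 w2) \o g1 = sumv d w1 by apply: funext => -[].
    have E2 d : sumv d (sumv w1 w2) \o g2 = sumv d w2 by apply: funext => -[].
    exists (J1 + J2)%type, (fun Y v => S1 Y (v \o g1) /\ S2 Y (v \o g2)), (sumv w1 w2).
    split.
    + by apply: udefinable_and; exact: udefinable_ren.
    + by case.
    + by rewrite E1 E2.
    + by move=> z /=; rewrite E1 E2 => -[/H1 ? /H2 ?].
  - by move=> V1 V2 V12 [J [S [w [dS Aw h H]]]]; exists J, S, w; split=> // z /H /V12.
have [U [UU FU]] := ultraFilterLemma FF.
have [c' hc'] := ultra_realized_udefinable satC UU C0.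
exists c' => J S w dS Aw Sbc.
pose g (u : ('I_m + 'I_k) + J) : 'I_k + ('I_m + J) := match u with
  | inl (inl u) => inr (inl u) | inl (inr t) => inl t | inr j => inr (inr j) end.
have E z : sumv z (sumv b' w) \o g = sumv (sumv b' z) w.
  by apply: funext => -[[]|].
rewrite -E; apply/(hc' _ (fun Y v => S Y (v \o g)) (sumv b' w) (udefinable_ren g dS)).
  by case=> [t|j] /=; [exact: Cb'|apply: AC; exact: Aw].
apply: FU; exists J, S, w; split=> // z /=.
by rewrite E.
Qed.

End Types.

(** * Invariance of the extension *)

Section Invariance.
Context (R : realType) (L : language) (P : Type) (ar : P -> nat).
Let L' := add_rel L ar.
Context (X : structure L') (n : nat).
Hypothesis honestX : forall n (q : formula L' n),
  honestly_definable (holds q : ('I_n -> X) -> Prop).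

(** Given an L-definable lower approximation [S(x,b,w)] of [q(x,b)], move [w] to
    [w'] so that [b,w] and [b',w'] have the same L'-type over [A].  Then
    [S(x,b',w')] lies inside [q(x,b')], and its measure is that of [S(x,b,w)] by
    invariance in L. *)
Lemma invariant_extension (nu : keisler R X n) (A B : set X) :
  has_nets (restrict_keisler nu) B ->
  (forall m (b : 'I_m -> X), exists C : set X,
    [/\ realizes_types_over C, C !=set0, A `<=` C & forall t, C (b t)]) ->
  invariant_over (restrict_keisler nu) A -> invariant_over nu A.
Proof.
move=> netB satA invA m q.
suff H (b b' : 'I_m -> X) : tp A b = tp A b' ->
    nu (instance_set q b) <= nu (instance_set q b').
  by move=> b b' bb'; apply/eqP; rewrite eq_le !H.
move=> bb'; rewrite !mass_instance; apply/ler_addgt0Pr => e e0.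
have [J [S [dS hS]]] := inner_approx honestX q netB.
have [w [D [dD wq qD Dw]]] := hS e e0 b.
have [C [satC C0 AC Cb']] := satA _ b'.
have [c' hc'] := tp_extend (k := #|J|) (w \o enum_val) satC C0 AC Cb' bb'.
pose w' := c' \o enum_rank.
have Ew : w = w \o enum_val \o enum_rank by apply: funext => j /=; rewrite enum_rankK.
have dq (c : 'I_m -> X) : definable [set x : 'I_n -> X | holds q (tcat x c)].
  by exists (PFormula q c).
have w'q x : S (reduct X) (sumv x (sumv b' w')) -> holds q (tcat x b').
  pose g1 (u : 'I_n + ('I_m + J)) : (('I_m + 'I_#|J|) + 'I_0) + 'I_n := match u with
    | inl u => inr u | inr (inl u) => inl (inl (inl u))
    | inr (inr j) => inl (inl (inr (enum_rank j))) end.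
  pose g2 (u : 'I_(n + m)) : (('I_m + 'I_#|J|) + 'I_0) + 'I_n := match fintype.split u with
    | inl u => inr u | inr u => inl (inl (inl u)) end.
  pose V (Y : structure L') (v : ('I_m + 'I_#|J|) + 'I_0 -> Y) := forall x : 'I_n -> Y,
    S (reduct Y) (sumv v x \o g1) -> holds q (sumv v x \o g2).
  have dV : udefinable V.
    apply: (@udefinable_forall _ _ _ (fun Y v => S (reduct Y) (v \o g1) -> holds q (v \o g2))).
    apply: udefinable_imp; last exact: udefinable_holds.
    exact: (udefinable_lift ar (udefinable_ren g1 dS)).
  have E1 (d : 'I_m -> X) (z : 'I_#|J| -> X) (y : 'I_n -> X) :
      sumv (sumv (sumv d z) (@ord0_elim X)) y \o g1 = sumv y (sumv d (z \o enum_rank)).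
    by apply: funext => -[|[]].
  have E2 (d : 'I_m -> X) (z : 'I_#|J| -> X) (y : 'I_n -> X) :
      sumv (sumv (sumv d z) (@ord0_elim X)) y \o g2 = tcat y d.
    by apply: funext => u; rewrite /= /g2 /tcat; case: fintype.split.
  have Vb : V X (sumv (sumv b (w \o (@enum_val J predT))) (@ord0_elim X)).
    by move=> y; rewrite E1 E2 -Ew; exact: wq.
  have A0 (t : 'I_0) : A (@ord0_elim X t) by case: t.
  by have := hc' _ V (@ord0_elim X) dV A0 Vb x; rewrite E1 E2.
have wE : mass (restrict_keisler nu) [set x | S (reduct X) (sumv x (sumv b w))] =
    mass (restrict_keisler nu) [set x | S (reduct X) (sumv x (sumv b' w'))].
  have [p hp] := udefinable_split_fin dS.
  have E (c : 'I_m + J -> X) : [set x | S (reduct X) (sumv x c)] =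
      [set x | @holds L (reduct X) _ p (tcat x (c \o enum_val))].
    by apply/seteqP; split=> x /=; rewrite (hp (reduct X) c).
  rewrite !E -!mass_instance; apply: invA.
  apply: tp_eqP.
  have imp (psi : pformula L A #|{: 'I_m + J}|) :
      @pholds L (reduct X) _ set_val _ psi (sumv b w \o enum_val) ->
      @pholds L (reduct X) _ set_val _ psi (sumv b' w' \o enum_val).
    pose g (u : 'I_(#|{: 'I_m + J}| + pf_arity psi)) :
        ('I_m + 'I_#|J|) + 'I_(pf_arity psi) := match fintype.split u with
      | inl t => inl (match enum_val t with inl t => inl t | inr j => inr (enum_rank j) end)
      | inr t => inr t end.
    pose V (Y : structure L') (v : ('I_m + 'I_#|J|) + 'I_(pf_arity psi) -> Y) :=
      @holds L (reduct Y) _ (pf_formula psi) (v \o g).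
    have dV : udefinable V by exact: (udefinable_lift ar (udefinable_holds (pf_formula psi) g)).
    have E' (d : 'I_m -> X) (z : 'I_#|J| -> X) :
        sumv (sumv d z) (set_val \o pf_param psi) \o g =
        tcat (sumv d (z \o enum_rank) \o enum_val) (set_val \o pf_param psi).
      apply: funext => u; rewrite /= /g /tcat; case: fintype.split => [t|t] //=.
      by case: (enum_val t).
    have Apsi t : A ((set_val \o pf_param psi) t) by exact: set_valP.
    have := hc' _ V _ dV Apsi; rewrite /V !E' -Ew; exact.
  move=> psi; split; first exact: imp.
  move=> h; apply: contrapT => n_h; have := imp (pneg psi) n_h.
  by apply; exact: h.
have dS' (c : 'I_m + J -> X) : definable ([set x | S (reduct X) (sumv x c)] : set ('I_n -> reduct X)).
  exact: definable_udefinable.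
apply: le_trans (le_mass nu (dq b) (definable_reduct dD) qD) _.
rewrite -(mass_restrict nu dD); apply: le_trans Dw _; rewrite lerD2r wE.
by rewrite (mass_restrict nu (dS' _)); apply: le_mass => //; exact: definable_reduct.
Qed.

End Invariance.

(** * Passing to the reduct *)

Section Reduct.
Context (L : language) (P : Type) (ar : P -> nat).
Let L' := add_rel L ar.
Context (X : structure L').

Lemma realizes_reduct (A : set X) :
  realizes_types_over A -> @realizes_types_over L (reduct X) A.
Proof.
move=> satA n p fp.
pose lift (psi : pformula L A n) : pformula L' A n :=
  PFormula (lift_formula ar (pf_formula psi)) (pf_param psi).
have liftE psi x : pholds set_val (lift psi) x = @pholds L (reduct X) _ set_val _ psi x.
  by rewrite /pholds /= holds_lift.
have [|a ha] := satA n (lift @` p); last first.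
  by exists a => psi ppsi; rewrite -liftE; apply: ha; exists psi.
move=> q fq qp.
have /choice [pre hpre] : forall psi', exists psi, q psi' -> p psi /\ lift psi = psi'.
  move=> psi'; have [/qp [psi ? ?]|nq] := EM (q psi'); first by exists psi.
  have [psi _] : exists psi : pformula L A n, True.
    by exists (PFormula (Bot : formula L (n + 0)) (@ord0_elim A)).
  by exists psi => /nq.
have [||a ha] := fp (pre @` q); first exact: finite_image.
  by move=> _ [psi' /hpre [? _] <-].
exists a => psi' qpsi'; have [_ <-] := hpre psi' qpsi'.
by rewrite liftE; apply: ha; exists psi'.
Qed.

Lemma elementary_reduct (A : set X) :
  elementary_substructure A -> @elementary_substructure L (reduct X) A.
Proof.
move=> [S [g [ge gA]]]; exists (reduct S), g; split=> // n p v.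
by rewrite -!holds_lift; exact: ge.
Qed.

Lemma nets_restrict (R : realType) n (nu : keisler R X n) (A : set X) :
  has_nets nu A -> has_nets (restrict_keisler nu) A.
Proof.
move=> netA J S dS e e0; have [k [a [Aa ha]]] := netA _ _ (udefinable_lift ar dS) e e0.
exists k, a; split=> // w; rewrite mass_restrict; last exact: definable_udefinable.
exact: ha.
Qed.

End Reduct.

(** The characterization through which generic stability is handled in both
    languages. *)
Lemma generically_stable_nets (K : Type) (R : realType) (L : language) (X : structure L) n
    (mu : keisler R X n) : saturated K X ->
  generically_stable K mu <->
    exists A : set X, [/\ small K A, elementary_substructure A & has_nets mu A].
Proof.
move=> satX; split=> [[A [sA eA dA fA]]|[A [sA eA netA]]]; exists A; split=> //.
- by apply: dfs_nets => //; exact: satX.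
- by apply: nets_dfs => //; exact: satX.
- exact: nets_fs.
Qed.

Theorem theorem3p9 (R : realType) (L : language) (T : theory L)
    (T_complete : complete_theory T) (T_NIP : NIP T)
    (M : structure L) (M_T : models M T)
    (N : structure L) (i : M -> N) (i_elem : elementary_embedding i)
    (N_sat : succ_saturated M N)
    (N' M' : structure L) (i' : M' -> N') (i'_emb : embedding i')
    (f : N -> N')
    (f_elem : @elementary_embedding _ (pair_structure i) (pair_structure i') f)
    (pair_sat : succ_saturated N (pair_structure i'))
    (Mt := shelah_structure i' f : structure (shelah_language L N))
    (K : Type)
    (Mt_monster : monster K (Th (shelah_expansion i)) Mt)
    (n : nat) :
  let restr : keisler R Mt n -> keisler R (reduct Mt) n :=
    fun mu' => restrict_keisler mu' in
  [/\ set_bij [set mu' | generically_stable K mu']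
              [set mu | generically_stable K mu] restr,
      forall mu' : keisler R Mt n, generically_stable K mu' ->
        forall nu : keisler R Mt n, restr nu = restr mu' -> nu = mu',
      forall (A : set M') (mu' : keisler R Mt n),
        small K A -> generically_stable K mu' ->
        fam_over mu' A -> fam_over (restr mu') A &
      forall (A : set M') (mu' : keisler R Mt n),
        small K A -> generically_stable K mu' ->
        generically_stable_over K (restr mu') A ->
        generically_stable_over K mu' A].
Proof.
move=> restr; have [Mt_Th Mt_sat K_big] := Mt_monster.
have MtT : models (reduct Mt) T by apply: (@models_reduct L M N i Mt Mt_Th T M_T).
have Mt_satL : saturated K (reduct Mt).
  by move=> A sA; apply: realizes_reduct; exact: Mt_sat.
have honestMt k (q : formula (shelah_language L N) k) :
    honestly_definable (holds q : ('I_k -> Mt) -> Prop).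
  apply: (honest_definition T_NIP MtT Mt_sat K_big).
  apply: (locally_definable_all_formulas T_NIP MtT Mt_sat K_big).
  exact: (@locally_definable_symbol L M N i i_elem Mt Mt_Th).
have restr_net mu' : generically_stable K mu' -> exists A, has_nets (restr mu') A.
  by move=> /(generically_stable_nets _ Mt_sat) [A [_ _ netA]]; exists A; exact: nets_restrict.
have uniq mu' : generically_stable K mu' ->
    forall nu : keisler R Mt n, restr nu = restr mu' -> nu = mu'.
  move=> /restr_net [A netA] nu e.
  by apply: (@extension_unique R _ _ _ Mt honestMt n A mu' nu netA e).
split=> //.
- split.
  + move=> mu' /(generically_stable_nets _ Mt_sat) [A [sA eA netA]].
    apply/(generically_stable_nets _ Mt_satL).
    by exists A; split=> //; [exact: elementary_reduct|exact: nets_restrict].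
  + move=> mu' nu' /set_mem gs _ e; exact/esym/uniq.
  + move=> mu /(generically_stable_nets _ Mt_satL) [A [_ _ netA]].
    have [nu nuE] := extension_exists honestMt netA; exists nu => //.
    have netA' : has_nets nu A by apply: nets_extension => //; rewrite nuE.
    have [A1 [_ cA1 netA1]] := nets_coded netA'.
    have [B [A1B cB eB]] := lowenheim_skolem cA1.
    apply/(generically_stable_nets _ Mt_sat); exists B; split=> //.
      exact: small_coded cB.
    exact: nets_sub netA1.
- move=> A mu' _ _ famA m p e e0.
  have [k [a [Aa ha]]] := famA m (lift_formula _ p) e e0.
  exists k, a; split=> // b; have := ha b.
  have -> : restr mu' (@instance_set L (reduct Mt) n m p b) =
      mu' (instance_set (lift_formula _ p) b).
    rewrite !mass_instance mass_restrict; last by exists (PFormula p b).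
    by congr (mass mu' _); apply/seteqP; split=> x /=; rewrite holds_lift.
  suff -> : [set j | `[< @holds _ Mt _ (lift_formula _ p) (tcat (a j) b) >]]%SET =
    [set j | `[< @holds L (reduct Mt) _ p (tcat (a j) b) >]]%SET by [].
  by apply/setP => j; rewrite !inE holds_lift.
- move=> A mu' sA gs [_ invA]; split=> //.
  have [B netB] := restr_net _ gs.
  apply: (invariant_extension honestMt netB _ invA) => m b.
  have [x0] := carrier_inhabited Mt.
  exists (A `|` range (tcons x0 b)); split.
  + by apply: Mt_sat; exact: small_setU_finite K_big sA.
  + by exists x0; right; exists ord0; rewrite ?tcons0.
  + by left.
  + by move=> t; right; exists (lift ord0 t); rewrite ?tcons_lift.
Qed.
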